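(* Let $f:R\to S$ be a ring homomorphism. The following conditions are equivalent. (1) $f$ is a ring epimorphism and makes $S$ into a flat left and a flat right $R$-module. (2) The family of left ideals $\mathfrak{F}_l=\{I\le {}_RR \mid Sf(I)=S\}$ is a left Gabriel filter on $R$, the family of right ideals $\mathfrak{F}_r=\{J\le R_R\mid f(J)S=S\}$ is a right Gabriel filter on $R$, and there is a ring isomorphism $g:S\cong {}_{\mathfrak{F}_l}R_{\mathfrak{F}_r}$ such that $g\circ f$ is the canonical map $q_R:R\to {}_{\mathfrak{F}_l}R_{\mathfrak{F}_r}$. (3) The following two conditions are satisfied. (i) For every $s\in S$ there are $r_i\in R$, $s_i\in S$ ($i=1,\dots,n$) and $r'_j\in R$, $s'_j\in S$ ($j=1,\dots,m$) such that $f(r_i)s\in f(R)$ for all $i$, $sf(r'_j)\in f(R)$ for all $j$, $\sum_{i=1}^n s_if(r_i)=1$ and $\sum_{j=1}^m f(r'_j)s'_j=1$. (ii) If $r\in R$ and $f(r)=0$, then there are $r_i\in R$, $s_i\in S$ ($i=1,\dots,n$) and $r'_j\in R$, $s'_j\in S$ ($j=1,\dots,m$) such that $r_ir=0$ for all $i$, $rr'_j=0$ for all $j$, $\sum_{i=1}^n s_if(r_i)=1$ and $\sum_{j=1}^m f(r'_j)s'_j=1$.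
   Context: Rings are associative with identity. A ring homomorphism $f:R\to S$ is a ring epimorphism if for all rings $T$ and homomorphisms $g,h:S\to T$, $gf=hf$ implies $g=h$. $Sf(I)$ denotes the left ideal of $S$ generated by $f(I)$, and $f(J)S$ the right ideal generated by $f(J)$. Symmetric ring of quotients. Let $\mathfrak{F}_l$ be a Gabriel filter of left ideals and $\mathfrak{F}_r$ a Gabriel filter of right ideals of $R$. For an $R$-bimodule $M$, ${}_l\mathcal{T}_r(M)$ denotes the set of $m\in M$ such that $Im=0$ and $mJ=0$ for some $I\in\mathfrak{F}_l$, $J\in\mathfrak{F}_r$. Put $\overline{R}=R/{}_l\mathcal{T}_r(R)$. A compatible pair is a pair $(a,b)$ where $a:I\to\overline{R}$ is a left $R$-homomorphism, $b:J\to\overline{R}$ is a right $R$-homomorphism, $I\in\mathfrak{F}_l$, $J\in\mathfrak{F}_r$, and $a(i)j=ib(j)$ for all $i\in I$, $j\in J$. Two compatible pairs $(a,b)$, $(c,d)$ are equivalent if $a$ and $c$ agree on some $I'\in\mathfrak{F}_l$ and $b$ and $d$ agree on some $J'\in\mathfrak{F}_r$. The symmetric ring of quotients ${}_{\mathfrak{F}_l}R_{\mathfrak{F}_r}$ is the set of equivalence classes of compatible pairs, with componentwise addition and multiplication induced by composition: $[(a_1,b_1)][(a_2,b_2)]=[(a_2\circ a_1,\ b_1\circ b_2)]$ on suitable smaller ideals in the filters. The canonical map $q_R:R\to{}_{\mathfrak{F}_l}R_{\mathfrak{F}_r}$ sends $r$ to the class of (right multiplication by $r$, left multiplication by $r$);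 its kernel is ${}_l\mathcal{T}_r(R)$. *)

(* Defs.v *)
From HB Require Import structures.
From mathcomp Require Import all_boot all_algebra generic_quotient.
From mathcomp Require Import boolp classical_sets.

Set Implicit Arguments.
Unset Strict Implicit.
Unset Printing Implicit Defensive.

Import GRing.Theory.

Local Open Scope classical_set_scope.
Local Open Scope ring_scope.
Local Open Scope quotient_scope.

(* Rings are [pzRingType]s: unital, associative, the zero ring being allowed. *)

Definition ring_epimorphism (R S : pzRingType) (f : {rmorphism R -> S}) :=
  forall (T : pzRingType) (g h : {rmorphism S -> T}),
    g \o f =1 h \o f -> g =1 h.

(* As usual in MathComp, right R-modules are left R^c-modules. *)

Section Tensor.
Variables (R : pzRingType) (M : lmodType R^c) (N : lmodType R).

(* The list [:: (m1, n1); ...; (mk, nk)] stands for the formal sum of the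
   mi (x) ni.  Opposites need no formal counterpart, as -(m (x) n) is
   (-m) (x) n; this uses the rule [tensor_zero]. *)
Inductive tensor_rel : seq (M * N) -> seq (M * N) -> Prop :=
| tensor_refl x : tensor_rel x x
| tensor_sym x y : tensor_rel x y -> tensor_rel y x
| tensor_trans x y z : tensor_rel x y -> tensor_rel y z -> tensor_rel x z
| tensor_cat x y x' y' :
    tensor_rel x x' -> tensor_rel y y' -> tensor_rel (x ++ y) (x' ++ y')
| tensor_comm x y : tensor_rel (x ++ y) (y ++ x)
| tensor_zero n : tensor_rel [:: (0, n)] [::]
| tensor_addl m m' n :
    tensor_rel [:: (m + m', n)] [:: (m, n); (m', n)]
| tensor_addr m n n' :
    tensor_rel [:: (m, n + n')] [:: (m, n); (m, n')]
| tensor_balanced m (r : R) n :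
    tensor_rel [:: ((r : R^c) *: m, n)] [:: (m, r *: n)].

Definition tensor_relb (x y : seq (M * N)) : bool := `[< tensor_rel x y >].

Lemma tensor_relb_refl : reflexive tensor_relb.
Proof. by move=> x; apply/asboolP; apply: tensor_refl. Qed.

Lemma tensor_relb_sym : symmetric tensor_relb.
Proof.
by move=> x y; apply/idP/idP => /asboolP h; apply/asboolP; apply: tensor_sym.
Qed.

Lemma tensor_relb_trans : transitive tensor_relb.
Proof.
move=> y x z /asboolP xy /asboolP yz; apply/asboolP.
exact: tensor_trans xy yz.
Qed.

Definition tensor_equiv : equiv_rel (seq (M * N)) :=
  EquivRel tensor_relb tensor_relb_refl tensor_relb_sym tensor_relb_trans.

Definition tensor : Type := {eq_quot tensor_equiv}.

HB.instance Definition _ := Choice.on tensor.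
HB.instance Definition _ := EqQuotient.on tensor.

Lemma tensorP (x y : seq (M * N)) :
  tensor_rel x y <-> \pi_tensor x = \pi_tensor y.
Proof.
split=> [h|/eqquotP/asboolP //].
by apply/eqquotP/asboolP.
Qed.

Lemma tensor_reprP (x : seq (M * N)) :
  tensor_rel (repr (\pi_tensor x)) x.
Proof. by apply/tensorP; rewrite reprK. Qed.

Definition pure_tensor (m : M) (n : N) : tensor := \pi_tensor [:: (m, n)].

Definition tensor_opp_seq (x : seq (M * N)) := [seq (- p.1, p.2) | p <- x].

Lemma tensor_opp_rel x y :
  tensor_rel x y -> tensor_rel (tensor_opp_seq x) (tensor_opp_seq y).
Proof.
elim=> {x y} /=.
- by move=> x; apply: tensor_refl.
- by move=> x y _; apply: tensor_sym.
- by move=> x y z _ xy _; apply: tensor_trans.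
- move=> x y x' y' _ hx _ hy.
  by rewrite /tensor_opp_seq !map_cat; apply: tensor_cat.
- by move=> x y; rewrite /tensor_opp_seq !map_cat; apply: tensor_comm.
- by move=> n; rewrite oppr0; apply: tensor_zero.
- by move=> m m' n; rewrite opprD; apply: tensor_addl.
- by move=> m n n'; apply: tensor_addr.
- by move=> m r n; rewrite -scalerN; apply: tensor_balanced.
Qed.

Definition tensor0 : tensor := \pi_tensor [::].
Definition tensor_add (x y : tensor) : tensor :=
  \pi_tensor (repr x ++ repr y).
Definition tensor_opp (x : tensor) : tensor :=
  \pi_tensor (tensor_opp_seq (repr x)).

Lemma tensor_pi_cat x y :
  \pi_tensor (x ++ y) = tensor_add (\pi_tensor x) (\pi_tensor y).
Proof.
apply/tensorP; apply: tensor_cat; apply: tensor_sym; exact: tensor_reprP.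
Qed.

Fact tensor_addA : associative tensor_add.
Proof.
elim/quotW=> x; elim/quotW=> y; elim/quotW=> z.
by rewrite -(tensor_pi_cat y z) -(tensor_pi_cat x y) -!tensor_pi_cat catA.
Qed.

Fact tensor_addC : commutative tensor_add.
Proof. by move=> x y; apply/tensorP; apply: tensor_comm. Qed.

Fact tensor_add0 : left_id tensor0 tensor_add.
Proof. by elim/quotW=> x; rewrite -(tensor_pi_cat [::] x). Qed.

Fact tensor_addN : left_inverse tensor0 tensor_opp tensor_add.
Proof.
move=> x; rewrite -{2}[x]reprK.
rewrite -(tensor_pi_cat (tensor_opp_seq (repr x)) (repr x)); apply/tensorP.
elim: (repr x) => [|[m n] s IHs] /=; first exact: tensor_refl.
have e : tensor_rel (tensor_opp_seq s ++ (m, n) :: s)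
                    ((m, n) :: tensor_opp_seq s ++ s).
  rewrite -cat1s catA -[in X in tensor_rel _ X]cat1s [in X in tensor_rel _ X]catA.
  by apply: tensor_cat; [exact: tensor_comm|exact: tensor_refl].
apply: (@tensor_trans _ ([:: (- m, n)] ++ ((m, n) :: tensor_opp_seq s ++ s))).
  exact: (tensor_cat (tensor_refl [:: (- m, n)]) e).
rewrite -[[:: (- m, n)] ++ _]/([:: (- m, n); (m, n)] ++ (tensor_opp_seq s ++ s)).
rewrite -[X in tensor_rel _ X](cats0 [::]); apply: tensor_cat => //.
apply: tensor_trans (tensor_zero n); rewrite -(addNr m).
by apply: tensor_sym; apply: tensor_addl.
Qed.

HB.instance Definition _ := GRing.isZmodule.Build tensor
  tensor_addA tensor_addC tensor_add0 tensor_addN.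

Lemma tensor_universal (A : zmodType) (b : M -> N -> A) :
  (forall m m' n, b (m + m') n = b m n + b m' n) ->
  (forall m n n', b m (n + n') = b m n + b m n') ->
  (forall m (r : R) n, b ((r : R^c) *: m) n = b m (r *: n)) ->
  exists! h : tensor -> A,
    (forall x y, h (x + y) = h x + h y) /\
    (forall m n, h (pure_tensor m n) = b m n).
Proof.
move=> bDl bDr bZ; pose h s := \sum_(p <- s) b p.1 p.2.
have b0n n : b 0 n = 0 by apply: (addrI (b 0 n)); rewrite -bDl !addr0.
have hE s t : tensor_rel s t -> h s = h t.
  rewrite /h; elim=> {s t} /=.
  - by [].
  - by move=> x y _ ->.
  - by move=> x y z _ -> _ ->.
  - by move=> x y x' y' _ hx _ hy; rewrite !big_cat /= hx hy.
  - by move=> x y; rewrite !big_cat /= addrC.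
  - by move=> n; rewrite big_cons !big_nil b0n addr0.
  - by move=> m m' n; rewrite !big_cons !big_nil !addr0 bDl.
  - by move=> m n n'; rewrite !big_cons !big_nil !addr0 bDr.
  - by move=> m r n; rewrite !big_cons !big_nil bZ.
have hpi s : h (repr (\pi_tensor s)) = h s by apply/hE/tensor_reprP.
exists (fun x => h (repr x)); split=> [|k [kD kb]].
  split=> [|m n]; last by rewrite hpi /h big_cons big_nil addr0.
  elim/quotW=> x; elim/quotW=> y.
  by rewrite -[_ + _](tensor_pi_cat x y) !hpi /h big_cat.
have k0 : k (\pi_tensor [::]) = 0.
  by apply: (addrI (k (\pi_tensor [::]))); rewrite -kD !addr0.
apply/funext; elim/quotW=> s; rewrite hpi.
elim: s => [|[m n] s IHs]; first by rewrite /h big_nil k0.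
rewrite /h big_cons -/(h s) IHs -kb -kD.
by rewrite -[_ + _](tensor_pi_cat [:: (m, n)] s).
Qed.

End Tensor.

Section TensorMap.
Variables (R : pzRingType) (M M' : lmodType R^c) (N N' : lmodType R).

Definition tensor_map (u : {linear M -> M'}) (v : {linear N -> N'})
    (x : tensor M N) : tensor M' N' :=
  \pi_(tensor M' N') [seq (u p.1, v p.2) | p <- repr x].

Lemma tensor_map_pi (u : {linear M -> M'}) (v : {linear N -> N'}) s :
  tensor_map u v (\pi_(tensor M N) s) =
  \pi_(tensor M' N') [seq (u p.1, v p.2) | p <- s].
Proof.
apply/tensorP; move: (repr _) (tensor_reprP s) => t; elim=> {s t} /=.
- by move=> x; apply: tensor_refl.
- by move=> x y _; apply: tensor_sym.
- by move=> x y z _ xy _; apply: tensor_trans.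
- by move=> x y x' y' _ hx _ hy; rewrite !map_cat; apply: tensor_cat.
- by move=> x y; rewrite !map_cat; apply: tensor_comm.
- by move=> n; rewrite linear0; apply: tensor_zero.
- by move=> m m' n; rewrite linearD; apply: tensor_addl.
- by move=> m n n'; rewrite linearD; apply: tensor_addr.
- by move=> m r n; rewrite !linearZ_LR; apply: tensor_balanced.
Qed.

End TensorMap.

Definition flat_left (R : pzRingType) (N : lmodType R) :=
  forall (M M' : lmodType R^c) (u : {linear M -> M'}),
    injective u -> injective (tensor_map u (idfun : {linear N -> N})).

Definition flat_right (R : pzRingType) (M : lmodType R^c) :=
  forall (N N' : lmodType R) (v : {linear N -> N'}),
    injective v -> injective (tensor_map (idfun : {linear M -> M}) v).

Section Restriction.
Variables (R S : pzRingType).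

(* S as a left, resp. right, R-module through f. *)
Definition left_restr (f : {rmorphism R -> S}) : Type := S.
Definition right_restr (f : {rmorphism R -> S}) : Type := S.

Variable f : {rmorphism R -> S}.

HB.instance Definition _ := GRing.Zmodule.copy (left_restr f) S.
HB.instance Definition _ := GRing.Zmodule.copy (right_restr f) S.

Definition left_restr_scale (r : R) (s : left_restr f) : left_restr f :=
  f r * (s : S).
Definition right_restr_scale (r : R^c) (s : right_restr f) : right_restr f :=
  (s : S) * f r.

Fact left_restr_scaleA a b v :
  left_restr_scale a (left_restr_scale b v) = left_restr_scale (a * b) v.
Proof. by rewrite /left_restr_scale rmorphM mulrA. Qed.
Fact left_restr_scale1 : left_id 1 left_restr_scale.
Proof. by move=> v; rewrite /left_restr_scale rmorph1 mul1r. Qed.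
Fact left_restr_scaleDr : right_distributive left_restr_scale +%R.
Proof. by move=> a v w; rewrite /left_restr_scale mulrDr. Qed.
Fact left_restr_scaleDl v : {morph left_restr_scale^~ v : a b / a + b}.
Proof. by move=> a b; rewrite /left_restr_scale rmorphD mulrDl. Qed.

HB.instance Definition _ := GRing.Zmodule_isLmodule.Build R (left_restr f)
  left_restr_scaleA left_restr_scale1 left_restr_scaleDr left_restr_scaleDl.

Fact right_restr_scaleA a b v :
  right_restr_scale a (right_restr_scale b v) = right_restr_scale (a * b) v.
Proof.
rewrite /right_restr_scale -[a * b]/((b : R) * (a : R)).
by rewrite (rmorphM f) mulrA.
Qed.
Fact right_restr_scale1 : left_id 1 right_restr_scale.
Proof. by move=> v; rewrite /right_restr_scale (rmorph1 f) mulr1. Qed.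
Fact right_restr_scaleDr : right_distributive right_restr_scale +%R.
Proof. by move=> a v w; rewrite /right_restr_scale mulrDl. Qed.
Fact right_restr_scaleDl v : {morph right_restr_scale^~ v : a b / a + b}.
Proof. by move=> a b; rewrite /right_restr_scale (rmorphD f) mulrDr. Qed.

HB.instance Definition _ := GRing.Zmodule_isLmodule.Build R^c (right_restr f)
  right_restr_scaleA right_restr_scale1 right_restr_scaleDr
  right_restr_scaleDl.

End Restriction.

Section Gabriel.
Variable R : pzRingType.
Implicit Types (I J : set R) (F : set (set R)).

Definition left_ideal I :=
  [/\ I 0, forall x y, I x -> I y -> I (x + y) &
      forall r x, I x -> I (r * x)].

Definition right_ideal J :=
  [/\ J 0, forall x y, J x -> J y -> J (x + y) &
      forall r x, J x -> J (x * r)].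

(* In order: nonempty, made of left ideals, closed upwards, under binary
   intersections and under (I : r) = {x | x r \in I}; and a left ideal I is
   in F as soon as all the (I : x), for x in some member of F, are. *)
Definition left_gabriel_filter F :=
  (exists I, F I) /\
  [/\ F `<=` left_ideal,
      forall I I', F I -> left_ideal I' -> I `<=` I' -> F I',
      forall I I', F I -> F I' -> F (I `&` I'),
      forall I r, F I -> F [set x | I (x * r)] &
      forall I I', left_ideal I -> F I' ->
        (forall x, I' x -> F [set y | I (y * x)]) -> F I].

Definition right_gabriel_filter F :=
  (exists J, F J) /\
  [/\ F `<=` right_ideal,
      forall J J', F J -> right_ideal J' -> J `<=` J' -> F J',
      forall J J', F J -> F J' -> F (J `&` J'),
      forall J r, F J -> F [set x | J (r * x)] &
      forall J J', right_ideal J -> F J' ->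
        (forall x, J' x -> F [set y | J (x * y)]) -> F J].

End Gabriel.

Definition left_filter (R S : pzRingType) (f : {rmorphism R -> S}) :
    set (set R) :=
  [set I | left_ideal I /\ smallest (@left_ideal S) (f @` I) = setT].

Definition right_filter (R S : pzRingType) (f : {rmorphism R -> S}) :
    set (set R) :=
  [set J | right_ideal J /\ smallest (@right_ideal S) (f @` J) = setT].

(* A partial homomorphism from R to a ring Q, which is an R-bimodule through
   p : R -> Q, is encoded by a total function whose values are relevant only
   on a domain I, given separately. *)

Section PartialHom.
Variables (R Q : pzRingType) (p : R -> Q).
Implicit Types (I J : set R) (a b : R -> Q) (F : set (set R)).

Definition left_hom_on I a :=
  (forall x y, I x -> I y -> a (x + y) = a x + a y) /\
  (forall r x, I x -> a (r * x) = p r * a x).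

Definition right_hom_on J b :=
  (forall x y, J x -> J y -> b (x + y) = b x + b y) /\
  (forall r x, J x -> b (x * r) = b x * p r).

Definition agree F I a I' a' :=
  exists2 K, F K & K `<=` I `&` I' /\ (forall x, K x -> a x = a' x).

(* The composite a' \o a of a, defined on I, and of the map induced by a' on
   the image of I' in Q: it sends x to a' y for any y \in I' with p y = a x. *)
Definition comp_dom I a I' := [set x | I x /\ exists2 y, I' y & p y = a x].
Definition comp_fun a I' a' :=
  fun x => a' (xget 0 [set y | I' y /\ p y = a x]).

End PartialHom.

Section LeftTheory.
Variables (R Q : pzRingType) (p : R -> Q).
Hypothesis pD : forall x y, p (x + y) = p x + p y.
Hypothesis pM : forall x y, p (x * y) = p x * p y.
Hypothesis p1 : p 1 = 1.
Hypothesis p_surj : forall q, exists r, p r = q.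
Variable F : set (set R).
Hypothesis GF : left_gabriel_filter F.
Implicit Types (I J : set R) (a b : R -> Q).

Let p0 : p 0 = 0.
Proof. by apply: (addrI (p 0)); rewrite -pD !addr0. Qed.
Let pN x : p (- x) = - p x.
Proof. by apply: (addrI (p x)); rewrite -pD !subrr. Qed.

Lemma idealN I x : left_ideal I -> I x -> I (- x).
Proof. by case=> _ _ IM Ix; rewrite -mulN1r; apply: IM. Qed.

Lemma ideal_setT : left_ideal (setT : set R). Proof. by split. Qed.

Lemma gab_ideal I : F I -> left_ideal I.
Proof. by case: GF => _ [+ _ _ _ _]; apply. Qed.

Lemma gab_setT : F setT.
Proof. by case: GF => -[I FI] [_ up _ _ _]; apply: (up I _ FI ideal_setT). Qed.

Lemma gabI I J : F I -> F J -> F (I `&` J).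
Proof. by case: GF => _ [_ _ h _ _]; apply: h. Qed.

Lemma gab_colon I r : F I -> F [set x | I (x * r)].
Proof. by case: GF => _ [_ _ _ h _]; apply: h. Qed.

Lemma hom0 I a : left_ideal I -> left_hom_on p I a -> a 0 = 0.
Proof.
by case=> I0 _ _ [aD _]; apply: (addrI (a 0)); rewrite -aD ?addr0.
Qed.

Lemma homB I a x y : left_ideal I -> left_hom_on p I a -> I x -> I y ->
  a (x - y) = a x - a y.
Proof.
move=> hI [aD aM] Ix Iy.
rewrite aD //; last exact: idealN.
by rewrite -[- y]mulN1r aM // pN p1 mulN1r.
Qed.

Lemma comp_dom_ideal I a I' : left_ideal I -> left_hom_on p I a ->
  left_ideal I' -> left_ideal (comp_dom p I a I').
Proof.
move=> hI ha hI'; case: (hI) (hI') (ha) => I0 ID IM [I'0 I'D I'M] [aD aM].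
split.
- by split=> //; exists 0; rewrite // p0 (hom0 hI ha).
- move=> x y [Ix [x' I'x' ex]] [Iy [y' I'y' ey]]; split; first exact: ID.
  by exists (x' + y'); [exact: I'D|rewrite pD aD // ex ey].
- move=> r x [Ix [x' I'x' ex]]; split; first exact: IM.
  by exists (r * x'); [exact: I'M|rewrite pM aM // ex].
Qed.

Lemma comp_dom_gab I a I' : F I -> left_hom_on p I a -> F I' ->
  F (comp_dom p I a I').
Proof.
move=> FI ha FI'; have hI := gab_ideal FI; have hI' := gab_ideal FI'.
have hC := comp_dom_ideal hI ha hI'.
case: (GF) => _ [_ up _ _ T4]; apply: (T4 _ I) => // x Ix.
have [r0 er0] := p_surj (a x).
apply: (up _ _ (gab_colon r0 FI')).
  case: hC => C0 CD CM; split=> /=.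
  - by rewrite mul0r.
  - by move=> y z hy hz; rewrite mulrDl; apply: CD.
  - by move=> r y hy; rewrite -mulrA; apply: CM.
move=> r /= I'r; case: hI => _ _ IM; case: ha => _ aM.
by split; [exact: IM|exists (r * r0); rewrite // pM aM // er0].
Qed.

(* a vanishes on the part of its domain that p kills *)
Definition kills I a := forall y, I y -> p y = 0 -> a y = 0.

Section Comp.
Variables (I I' : set R) (a a' : R -> Q).
Hypotheses (hI : left_ideal I) (ha : left_hom_on p I a).
Hypotheses (hI' : left_ideal I') (ha' : left_hom_on p I' a').
Hypothesis ka' : kills I' a'.

Lemma comp_funE x y : I' y -> p y = a x -> comp_fun p a I' a' x = a' y.
Proof.
move=> I'y e; rewrite /comp_fun; case: xgetP => [z _ [I'z ez]|/(_ y)] /=.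
  apply/eqP; rewrite -subr_eq0 -(homB hI' ha') //; apply/eqP/ka'.
    by case: hI' => _ + _; apply => //; apply: idealN.
  by rewrite pD pN ez e subrr.
by case.
Qed.

Lemma comp_hom : left_hom_on p (comp_dom p I a I') (comp_fun p a I' a').
Proof.
case: hI hI' ha ha' => I0 ID IM [I'0 I'D I'M] [aD aM] [a'D a'M].
split=> [x y [Ix [x' I'x' ex]] [Iy [y' I'y' ey]]|r x [Ix [x' I'x' ex]]].
  rewrite (comp_funE I'x' ex) (comp_funE I'y' ey) -a'D //.
  by apply: comp_funE; [exact: I'D|rewrite pD aD // ex ey].
rewrite (comp_funE I'x' ex) -a'M //.
by apply: comp_funE; [exact: I'M|rewrite pM aM // ex].
Qed.

End Comp.

Lemma add_hom I I' a a' : left_hom_on p I a -> left_hom_on p I' a' ->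
  left_hom_on p (I `&` I') (fun x => a x + a' x).
Proof.
move=> [aD aM] [a'D a'M]; split=> [x y [Ix I'x] [Iy I'y]|r x [Ix I'x]].
  by rewrite aD // a'D // addrACA.
by rewrite aM // a'M // mulrDr.
Qed.

Lemma opp_hom I a : left_hom_on p I a -> left_hom_on p I (fun x => - a x).
Proof.
move=> [aD aM]; split=> [x y Ix Iy|r x Ix]; first by rewrite aD // opprD.
by rewrite aM // mulrN.
Qed.

Lemma mulr_hom r : left_hom_on p setT (fun x => p (x * r)).
Proof. by split=> [x y _ _|s x _]; rewrite ?mulrDl ?pD // -mulrA pM. Qed.

Lemma agree_refl I a : F I -> agree F I a I a.
Proof. by move=> FI; exists I => //; split. Qed.

Lemma agree_sym I a I' a' : agree F I a I' a' -> agree F I' a' I a.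
Proof.
case=> K FK [sK eK]; exists K => //; split; first by rewrite setIC.
by move=> x /eK.
Qed.

Lemma agree_trans I1 a1 I2 a2 I3 a3 :
  agree F I1 a1 I2 a2 -> agree F I2 a2 I3 a3 -> agree F I1 a1 I3 a3.
Proof.
move=> [K FK [sK eK]] [L FL [sL eL]]; exists (K `&` L); first exact: gabI.
split=> [x [/sK[? ?] /sL[? ?]] //|x [Kx Lx]]; by rewrite eK // eL.
Qed.

Lemma agree_on I a I' a' : F I -> F I' ->
  (forall x, I x -> I' x -> a x = a' x) -> agree F I a I' a'.
Proof.
move=> FI FI' h; exists (I `&` I'); first exact: gabI.
by split=> // x [Ix I'x]; apply: h.
Qed.

Lemma agree_add I1 a1 I1' a1' I2 a2 I2' a2' :
  agree F I1 a1 I1' a1' -> agree F I2 a2 I2' a2' ->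
  agree F (I1 `&` I2) (fun x => a1 x + a2 x)
          (I1' `&` I2') (fun x => a1' x + a2' x).
Proof.
move=> [K FK [sK eK]] [L FL [sL eL]]; exists (K `&` L); first exact: gabI.
split=> [x [/sK[? ?] /sL[? ?]] //|x [Kx Lx]]; by rewrite eK // eL.
Qed.

Lemma agree_opp I a I' a' : agree F I a I' a' ->
  agree F I (fun x => - a x) I' (fun x => - a' x).
Proof.
by case=> K FK [sK eK]; exists K => //; split=> // x Kx; rewrite eK.
Qed.

Lemma agree_comp I1 a1 I1' a1' I2 a2 I2' a2' :
  F I1 -> left_hom_on p I1 a1 ->
  F I2 -> left_hom_on p I2 a2 -> kills I2 a2 ->
  F I2' -> left_hom_on p I2' a2' -> kills I2' a2' ->
  agree F I1 a1 I1' a1' -> agree F I2 a2 I2' a2' ->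
  agree F (comp_dom p I1 a1 I2) (comp_fun p a1 I2 a2)
          (comp_dom p I1' a1' I2') (comp_fun p a1' I2' a2').
Proof.
move=> F1 h1 F2 h2 k2 F2' h2' k2' [K FK [sK eK]] [L FL [sL eL]].
exists (K `&` comp_dom p I1 a1 L).
  by apply: gabI => //; apply: comp_dom_gab.
split=> x [Kx [I1x [y Ly ey]]].
  have [_ I1'x] := sK _ Kx; have [I2y I2'y] := sL _ Ly.
  by split; split=> //; exists y => //; rewrite -eK.
have [I2y I2'y] := sL _ Ly.
rewrite (comp_funE (gab_ideal F2) h2 k2 I2y ey).
by rewrite (comp_funE (gab_ideal F2') h2' k2' I2'y) -?eK // eL.
Qed.

Lemma comp_assoc I1 a1 I2 a2 I3 a3 :
  F I1 -> left_hom_on p I1 a1 ->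
  F I2 -> left_hom_on p I2 a2 -> kills I2 a2 ->
  F I3 -> left_hom_on p I3 a3 -> kills I3 a3 ->
  kills (comp_dom p I2 a2 I3) (comp_fun p a2 I3 a3) ->
  agree F
    (comp_dom p I1 a1 (comp_dom p I2 a2 I3))
    (comp_fun p a1 (comp_dom p I2 a2 I3) (comp_fun p a2 I3 a3))
    (comp_dom p (comp_dom p I1 a1 I2) (comp_fun p a1 I2 a2) I3)
    (comp_fun p (comp_fun p a1 I2 a2) I3 a3).
Proof.
move=> F1 h1 F2 h2 k2 F3 h3 k3 k23.
have i2 := gab_ideal F2; have i3 := gab_ideal F3.
have F12 : F (comp_dom p I1 a1 I2) by apply: comp_dom_gab.
have F23 : F (comp_dom p I2 a2 I3) by apply: comp_dom_gab.
have h12 := comp_hom (gab_ideal F1) h1 i2 h2 k2.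
have h23 := comp_hom i2 h2 i3 h3 k3.
apply: agree_on; [exact: comp_dom_gab|exact: comp_dom_gab|].
move=> x [I1x [y hy ey]] _; have [I2y [z I3z ez]] := hy.
rewrite (comp_funE (gab_ideal F23) h23 k23 hy ey) (comp_funE i3 h3 k3 I3z ez).
by rewrite (comp_funE i3 h3 k3 I3z) // (comp_funE i2 h2 k2 I2y ey).
Qed.

Lemma comp_1l I a : F I -> left_hom_on p I a -> kills I a ->
  agree F (comp_dom p setT (fun x => p (x * 1)) I)
          (comp_fun p (fun x => p (x * 1)) I a) I a.
Proof.
move=> FI ha ka; apply: agree_on => //.
  by apply: comp_dom_gab => //; [exact: gab_setT|exact: mulr_hom].
by move=> x _ Ix; apply: (comp_funE (gab_ideal FI) ha ka) => //; rewrite mulr1.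
Qed.

Lemma comp_1r I a : F I -> left_hom_on p I a ->
  agree F (comp_dom p I a setT) (comp_fun p a setT (fun x => p (x * 1))) I a.
Proof.
move=> FI ha; apply: agree_on => //.
  by apply: comp_dom_gab => //; exact: gab_setT.
move=> x [_ [y _ ey]] _.
rewrite (comp_funE ideal_setT (mulr_hom 1) _ (y := y)) ?mulr1 //.
by move=> z _ z0; rewrite mulr1.
Qed.

Lemma comp_addl I1 a1 I2 a2 I3 a3 :
  F I1 -> left_hom_on p I1 a1 -> F I2 -> left_hom_on p I2 a2 ->
  F I3 -> left_hom_on p I3 a3 -> kills I3 a3 ->
  agree F
    (comp_dom p (I1 `&` I2) (fun x => a1 x + a2 x) I3)
    (comp_fun p (fun x => a1 x + a2 x) I3 a3)
    (comp_dom p I1 a1 I3 `&` comp_dom p I2 a2 I3)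
    (fun x => comp_fun p a1 I3 a3 x + comp_fun p a2 I3 a3 x).
Proof.
move=> F1 h1 F2 h2 F3 h3 k3; have i3 := gab_ideal F3.
apply: agree_on.
- by apply: comp_dom_gab; [exact: gabI|exact: add_hom|].
- by apply: gabI; apply: comp_dom_gab.
move=> x _ [[I1x [y I3y ey]] [I2x [z I3z ez]]].
rewrite (comp_funE i3 h3 k3 I3y ey) (comp_funE i3 h3 k3 I3z ez).
case: (h3) => <- // _; apply: comp_funE => //; last by rewrite pD ey ez.
by case: i3 => _ + _; apply.
Qed.

Lemma comp_addr I1 a1 I2 a2 I3 a3 :
  F I1 -> left_hom_on p I1 a1 ->
  F I2 -> left_hom_on p I2 a2 -> kills I2 a2 ->
  F I3 -> left_hom_on p I3 a3 -> kills I3 a3 ->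
  agree F
    (comp_dom p I1 a1 (I2 `&` I3))
    (comp_fun p a1 (I2 `&` I3) (fun x => a2 x + a3 x))
    (comp_dom p I1 a1 I2 `&` comp_dom p I1 a1 I3)
    (fun x => comp_fun p a1 I2 a2 x + comp_fun p a1 I3 a3 x).
Proof.
move=> F1 h1 F2 h2 k2 F3 h3 k3.
have F23 := gabI F2 F3.
apply: agree_on; first exact: comp_dom_gab.
  by apply: gabI; apply: comp_dom_gab.
move=> x [I1x [y [I2y I3y] ey]] _.
rewrite (comp_funE (gab_ideal F2) h2 k2 I2y ey).
rewrite (comp_funE (gab_ideal F3) h3 k3 I3y ey).
rewrite (comp_funE (gab_ideal F23) (add_hom h2 h3) _ (y := y)) //.
by move=> z [I2z I3z] z0; rewrite k2 // k3 // addr0.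
Qed.

End LeftTheory.

Section Quotients.
Variables (R : pzRingType) (Fl Fr : set (set R)).

Definition torsion : set R :=
  [set m | (exists2 I, Fl I & forall i, I i -> i * m = 0) /\
           (exists2 J, Fr J & forall j, J j -> m * j = 0)].

Hypotheses (Gl : left_gabriel_filter Fl) (Gr : right_gabriel_filter Fr).

Let Gr' : @left_gabriel_filter R^c Fr := Gr.

Lemma torsion0 : torsion 0.
Proof.
split; exists setT.
- exact: gab_setT Gl.
- by move=> i _; rewrite mulr0.
- exact: gab_setT Gr'.
- by move=> i _; rewrite mul0r.
Qed.

Lemma torsionB x y : torsion x -> torsion y -> torsion (x - y).
Proof.
move=> [[I FI xI] [J FJ xJ]] [[I' FI' yI] [J' FJ' yJ]]; split.
  exists (I `&` I'); first exact: gabI Gl _ _ FI FI'.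
  by move=> i [Ii I'i]; rewrite mulrBr xI // yI // subrr.
exists (J `&` J'); first exact: gabI Gr' _ _ FJ FJ'.
by move=> i [Ii I'i]; rewrite mulrBl xJ // yJ // subrr.
Qed.

Lemma torsionMl r x : torsion x -> torsion (r * x).
Proof.
move=> [[I FI xI] [J FJ xJ]]; split.
  exists [set y | I (y * r)]; first exact: gab_colon Gl _ r FI.
  by move=> i /= Iir; rewrite mulrA xI.
by exists J => // j Jj; rewrite -mulrA xJ // mulr0.
Qed.

Lemma torsionMr r x : torsion x -> torsion (x * r).
Proof.
move=> [[I FI xI] [J FJ xJ]]; split.
  by exists I => // i Ii; rewrite mulrA xI // mul0r.
exists [set y | J (r * y)]; first exact: gab_colon Gr' _ r FJ.
by move=> i /= Iir; rewrite -mulrA xJ.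
Qed.

Lemma torsionN x : torsion x -> torsion (- x).
Proof. by move=> tx; rewrite -sub0r; apply: torsionB => //; apply: torsion0. Qed.

Lemma torsionD x y : torsion x -> torsion y -> torsion (x + y).
Proof.
by move=> tx ty; rewrite -[y]opprK; apply: torsionB => //; apply: torsionN.
Qed.

Definition torsion_relb (x y : R) : bool := `[< torsion (x - y) >].

Lemma torsion_relb_refl : reflexive torsion_relb.
Proof. by move=> x; apply/asboolP; rewrite subrr; apply: torsion0. Qed.

Lemma torsion_relb_sym : symmetric torsion_relb.
Proof.
by move=> x y; apply/idP/idP => /asboolP h; apply/asboolP;
   rewrite -opprB; apply: torsionN.
Qed.

Lemma torsion_relb_trans : transitive torsion_relb.
Proof.
move=> y x z /asboolP xy /asboolP yz; apply/asboolP.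
by rewrite -(subrKA y); apply: torsionD.
Qed.

Definition torsion_equiv : equiv_rel R :=
  EquivRel torsion_relb torsion_relb_refl torsion_relb_sym torsion_relb_trans.

(* R / torsion, as a quotient ring.  Its R-bimodule structure is the one
   given by multiplication by images of elements of R. *)
Definition Rbar : Type := {eq_quot torsion_equiv}.

HB.instance Definition _ := Choice.on Rbar.
HB.instance Definition _ := EqQuotient.on Rbar.

Definition Rbar_pi (x : R) : Rbar := \pi_Rbar x.

Lemma Rbar_piP x y : torsion (x - y) <-> Rbar_pi x = Rbar_pi y.
Proof. by split=> [h|/eqquotP/asboolP //]; apply/eqquotP/asboolP. Qed.

Lemma Rbar_repr (x : Rbar) : Rbar_pi (repr x) = x.
Proof. exact: reprK. Qed.

Lemma Rbar_reprP x : torsion (repr (Rbar_pi x) - x).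
Proof. by apply/Rbar_piP; rewrite Rbar_repr. Qed.

Definition Rbar_add (x y : Rbar) := Rbar_pi (repr x + repr y).
Definition Rbar_opp (x : Rbar) := Rbar_pi (- repr x).
Definition Rbar_mul (x y : Rbar) := Rbar_pi (repr x * repr y).

Lemma Rbar_piD' x y : Rbar_add (Rbar_pi x) (Rbar_pi y) = Rbar_pi (x + y).
Proof.
apply/Rbar_piP; rewrite opprD addrACA.
by apply: torsionD; apply: Rbar_reprP.
Qed.

Lemma Rbar_piN' x : Rbar_opp (Rbar_pi x) = Rbar_pi (- x).
Proof.
by apply/Rbar_piP; rewrite -opprD; apply: torsionN; apply: Rbar_reprP.
Qed.

Lemma Rbar_piM' x y : Rbar_mul (Rbar_pi x) (Rbar_pi y) = Rbar_pi (x * y).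
Proof.
apply/Rbar_piP; set x' := repr _; set y' := repr _.
have -> : x' * y' - x * y = (x' - x) * y' + x * (y' - y).
  by rewrite mulrBl mulrBr subrKA.
apply: torsionD; first exact/torsionMr/Rbar_reprP.
exact/torsionMl/Rbar_reprP.
Qed.

Let RbarE := (Rbar_piD', Rbar_piN', Rbar_piM').

Fact Rbar_addA : associative Rbar_add.
Proof.
elim/quotW=> x; elim/quotW=> y; elim/quotW=> z.
by rewrite (Rbar_piD' y z) (Rbar_piD' x y) !RbarE addrA.
Qed.
Fact Rbar_addC : commutative Rbar_add.
Proof. by elim/quotW=> x; elim/quotW=> y; rewrite (Rbar_piD' x y) (Rbar_piD' y x) addrC. Qed.
Fact Rbar_add0 : left_id (Rbar_pi 0) Rbar_add.
Proof. by elim/quotW=> x; rewrite (Rbar_piD' 0 x) add0r. Qed.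
Fact Rbar_addN : left_inverse (Rbar_pi 0) Rbar_opp Rbar_add.
Proof. by elim/quotW=> x; rewrite (Rbar_piN' x) (Rbar_piD' (- x) x) addNr. Qed.

HB.instance Definition _ := GRing.isZmodule.Build Rbar
  Rbar_addA Rbar_addC Rbar_add0 Rbar_addN.

Fact Rbar_mulA : associative Rbar_mul.
Proof.
elim/quotW=> x; elim/quotW=> y; elim/quotW=> z.
by rewrite (Rbar_piM' y z) (Rbar_piM' x y) !RbarE mulrA.
Qed.
Fact Rbar_mul1 : left_id (Rbar_pi 1) Rbar_mul.
Proof. by elim/quotW=> x; rewrite (Rbar_piM' 1 x) mul1r. Qed.
Fact Rbar_mulr1 : right_id (Rbar_pi 1) Rbar_mul.
Proof. by elim/quotW=> x; rewrite (Rbar_piM' x 1) mulr1. Qed.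
Fact Rbar_mulDl : left_distributive Rbar_mul Rbar_add.
Proof.
elim/quotW=> x; elim/quotW=> y; elim/quotW=> z.
by rewrite (Rbar_piD' x y) (Rbar_piM' x z) (Rbar_piM' y z) !RbarE mulrDl.
Qed.
Fact Rbar_mulDr : right_distributive Rbar_mul Rbar_add.
Proof.
elim/quotW=> x; elim/quotW=> y; elim/quotW=> z.
by rewrite (Rbar_piD' y z) (Rbar_piM' x y) (Rbar_piM' x z) !RbarE mulrDr.
Qed.

HB.instance Definition _ := GRing.Zmodule_isPzRing.Build Rbar
  Rbar_mulA Rbar_mul1 Rbar_mulr1 Rbar_mulDl Rbar_mulDr.

Lemma Rbar_piD x y : Rbar_pi (x + y) = Rbar_pi x + Rbar_pi y.
Proof. by rewrite -Rbar_piD'. Qed.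
Lemma Rbar_piM x y : Rbar_pi (x * y) = Rbar_pi x * Rbar_pi y.
Proof. by rewrite -Rbar_piM'. Qed.
Lemma Rbar_pi1 : Rbar_pi 1 = 1. Proof. by []. Qed.
Lemma Rbar_pi_surj (q : Rbar) : exists r, Rbar_pi r = q.
Proof. by exists (repr q); rewrite Rbar_repr. Qed.
Lemma Rbar_pi_eq0 x : Rbar_pi x = 0 <-> torsion x.
Proof. by rewrite -[X in torsion X]subr0; split=> /Rbar_piP. Qed.

Let Rbar_piM_c (x y : R^c) :
  (Rbar_pi (x * y) : Rbar^c) = (Rbar_pi x : Rbar^c) * (Rbar_pi y : Rbar^c).
Proof. exact: Rbar_piM. Qed.

Lemma Rbar_torsion_free I J (q : Rbar) : Fl I -> Fr J ->
  (forall i, I i -> Rbar_pi i * q = 0) ->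
  (forall j, J j -> q * Rbar_pi j = 0) -> q = 0.
Proof.
move=> FI FJ; have [r <-] := Rbar_pi_surj q => hI hJ; apply/Rbar_pi_eq0; split.
  exists [set x | x * r = 0] => //.
  case: (Gl) => _ [_ up _ _ T4]; apply: (T4 _ I) => //.
    split=> /= [|x y ex ey|s x ex]; first by rewrite mul0r.
      by rewrite mulrDl ex ey addr0.
    by rewrite -mulrA ex mulr0.
  move=> x Ix; have : Rbar_pi (x * r) = 0 by rewrite Rbar_piM hI.
  move=> /Rbar_pi_eq0[[K FK hK] _]; apply: (up _ _ FK).
    split=> /= [|y z ey ez|s y ey]; first by rewrite !mul0r.
      by rewrite !mulrDl ey ez addr0.
    by rewrite -!mulrA [y * _]mulrA ey mulr0.
  by move=> y Ky /=; rewrite -mulrA hK.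
exists [set x | r * x = 0] => //.
case: (Gr) => _ [_ up _ _ T4]; apply: (T4 _ J) => //.
  split=> /= [|x y ex ey|s x ex]; first by rewrite mulr0.
    by rewrite mulrDr ex ey addr0.
  by rewrite mulrA ex mul0r.
move=> x Jx; have : Rbar_pi (r * x) = 0 by rewrite Rbar_piM hJ.
move=> /Rbar_pi_eq0[_ [K FK hK]]; apply: (up _ _ FK).
  split=> /= [|y z ey ez|s y ey]; first by rewrite !mulr0.
    by rewrite !mulrDr ey ez addr0.
  by rewrite !mulrA -[r * x * y]mulrA ey mul0r.
by move=> y Ky /=; rewrite mulrA hK.
Qed.

Record compatible_pair : Type := CompatiblePair {
  ldom : set R;
  lfun : R -> Rbar;
  rdom : set R;
  rfun : R -> Rbar;
  ldomP : Fl ldom;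
  lfunP : left_hom_on Rbar_pi ldom lfun;
  rdomP : Fr rdom;
  rfunP : right_hom_on Rbar_pi rdom rfun;
  compatible : forall i j, ldom i -> rdom j ->
    lfun i * Rbar_pi j = Rbar_pi i * rfun j }.

HB.instance Definition _ := gen_eqMixin compatible_pair.
HB.instance Definition _ := gen_choiceMixin compatible_pair.

Definition pair_rel (u v : compatible_pair) :=
  agree Fl (ldom u) (lfun u) (ldom v) (lfun v) /\
  agree Fr (rdom u) (rfun u) (rdom v) (rfun v).

Definition pair_relb (u v : compatible_pair) : bool := `[< pair_rel u v >].

Lemma pair_relb_refl : reflexive pair_relb.
Proof.
move=> u; apply/asboolP; split; apply: agree_refl; [exact: ldomP|exact: rdomP].
Qed.

Lemma pair_relb_sym : symmetric pair_relb.
Proof.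
by move=> u v; apply/idP/idP => /asboolP[h h']; apply/asboolP;
   split; apply: agree_sym.
Qed.

Lemma pair_relb_trans : transitive pair_relb.
Proof.
move=> v u w /asboolP[uv uv'] /asboolP[vw vw']; apply/asboolP; split.
  exact: agree_trans Gl _ _ _ _ _ _ uv vw.
exact: (agree_trans Gr' uv' vw').
Qed.

Definition pair_equiv : equiv_rel compatible_pair :=
  EquivRel pair_relb pair_relb_refl pair_relb_sym pair_relb_trans.

Definition symquot : Type := {eq_quot pair_equiv}.

HB.instance Definition _ := Choice.on symquot.
HB.instance Definition _ := EqQuotient.on symquot.

Lemma symquotP u v : pair_rel u v <-> \pi_symquot u = \pi_symquot v.
Proof. by split=> [h|/eqquotP/asboolP //]; apply/eqquotP/asboolP. Qed.

Lemma symquot_reprP u : pair_rel (repr (\pi_symquot u)) u.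
Proof. by apply/symquotP; rewrite reprK. Qed.

Implicit Types u v w : compatible_pair.

Let rfunP' u : @left_hom_on R^c Rbar^c Rbar_pi (rdom u) (rfun u).
Proof. exact: rfunP. Qed.

Lemma lfun_kills u : kills Rbar_pi (ldom u) (lfun u).
Proof.
move=> t It /Rbar_pi_eq0[[I FI hI] [J FJ hJ]].
have FC : Fr (comp_dom Rbar_pi (rdom u) (rfun u) J).
  apply: (@comp_dom_gab R^c Rbar^c _ Rbar_piD Rbar_piM_c Rbar_pi_surj _ Gr') => //.
  exact: rdomP.
apply: (Rbar_torsion_free FI FC) => [i Ii|j [Jj [k Jk ek]]].
  case: (lfunP u) => _ <- //; rewrite hI //.
  exact: (hom0 (gab_ideal Gl (ldomP u)) (lfunP u)).
rewrite compatible // -ek -Rbar_piM hJ //.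
Qed.

Lemma rfun_kills u : @kills R^c Rbar^c Rbar_pi (rdom u) (rfun u).
Proof.
move=> t Jt /Rbar_pi_eq0[[I FI hI] [J FJ hJ]].
have FC : Fl (comp_dom Rbar_pi (ldom u) (lfun u) I).
  apply: (comp_dom_gab Rbar_piD Rbar_piM Rbar_pi_surj Gl) => //.
    exact: ldomP.
  exact: lfunP.
apply: (Rbar_torsion_free FC FJ) => [i [Ii [k Ik ek]]|j Jj].
  by rewrite -compatible // -ek -Rbar_piM hI.
case: (rfunP u) => _ <- //; rewrite hJ //.
exact: (hom0 (gab_ideal Gr' (rdomP u)) (rfunP' u)).
Qed.

Section Ops.
Variables u v : compatible_pair.

Fact add_lfunP :
  left_hom_on Rbar_pi (ldom u `&` ldom v) (fun x => lfun u x + lfun v x).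
Proof. exact: add_hom (lfunP u) (lfunP v). Qed.

Fact add_rfunP :
  right_hom_on Rbar_pi (rdom u `&` rdom v) (fun x => rfun u x + rfun v x).
Proof. exact: (@add_hom R^c Rbar^c _ _ _ _ _ (rfunP' u) (rfunP' v)). Qed.

Fact add_compatible i j : (ldom u `&` ldom v) i -> (rdom u `&` rdom v) j ->
  (lfun u i + lfun v i) * Rbar_pi j = Rbar_pi i * (rfun u j + rfun v j).
Proof. by move=> [ui vi] [uj vj]; rewrite mulrDl mulrDr !compatible. Qed.

Definition pair_add : compatible_pair :=
  CompatiblePair (gabI Gl (ldomP u) (ldomP v)) add_lfunP
    (gabI Gr' (rdomP u) (rdomP v)) add_rfunP add_compatible.

Fact opp_lfunP : left_hom_on Rbar_pi (ldom u) (fun x => - lfun u x).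
Proof. exact: opp_hom (lfunP u). Qed.

Fact opp_rfunP : right_hom_on Rbar_pi (rdom u) (fun x => - rfun u x).
Proof. exact: (@opp_hom R^c Rbar^c _ _ _ (rfunP' u)). Qed.

Fact opp_compatible i j : ldom u i -> rdom u j ->
  - lfun u i * Rbar_pi j = Rbar_pi i * - rfun u j.
Proof. by move=> ui uj; rewrite mulNr mulrN compatible. Qed.

Definition pair_opp : compatible_pair :=
  CompatiblePair (ldomP u) opp_lfunP (rdomP u) opp_rfunP opp_compatible.

(* (a1, b1) (a2, b2) = (a2 \o a1, b1 \o b2) *)
Definition mul_ldom := comp_dom Rbar_pi (ldom u) (lfun u) (ldom v).
Definition mul_lfun := comp_fun Rbar_pi (lfun u) (ldom v) (lfun v).
Definition mul_rdom := comp_dom Rbar_pi (rdom v) (rfun v) (rdom u).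
Definition mul_rfun := comp_fun Rbar_pi (rfun v) (rdom u) (rfun u).

Lemma mul_lfunE x y : ldom v y -> Rbar_pi y = lfun u x ->
  mul_lfun x = lfun v y.
Proof.
move=> vy e.
apply: (comp_funE Rbar_piD Rbar_pi1 (gab_ideal Gl (ldomP v))) => //.
  exact: lfunP.
exact: lfun_kills.
Qed.

Lemma mul_rfunE x y : rdom u y -> Rbar_pi y = rfun v x ->
  mul_rfun x = rfun u y.
Proof.
move=> vy e.
apply: (@comp_funE R^c Rbar^c _ Rbar_piD Rbar_pi1 _ _ _
  (gab_ideal Gr' (rdomP u)) (rfunP' u)) => //.
exact: rfun_kills.
Qed.

Fact mul_ldomP : Fl mul_ldom.
Proof.
exact: (comp_dom_gab Rbar_piD Rbar_piM Rbar_pi_surj Gl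
         (ldomP u) (lfunP u) (ldomP v)).
Qed.

Fact mul_lfunP : left_hom_on Rbar_pi mul_ldom mul_lfun.
Proof.
exact: (comp_hom Rbar_piD Rbar_piM Rbar_pi1 (gab_ideal Gl (ldomP u)) (lfunP u)
         (gab_ideal Gl (ldomP v)) (lfunP v) (@lfun_kills v)).
Qed.

Fact mul_rdomP : Fr mul_rdom.
Proof.
exact: (@comp_dom_gab R^c Rbar^c _ Rbar_piD Rbar_piM_c Rbar_pi_surj _ Gr'
         _ _ _ (rdomP v) (rfunP' v) (rdomP u)).
Qed.

Fact mul_rfunP : right_hom_on Rbar_pi mul_rdom mul_rfun.
Proof.
exact: (@comp_hom R^c Rbar^c _ Rbar_piD Rbar_piM_c Rbar_pi1 _ _ _ _
         (gab_ideal Gr' (rdomP v)) (rfunP' v)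
         (gab_ideal Gr' (rdomP u)) (rfunP' u) (@rfun_kills u)).
Qed.

Fact mul_compatible i j : mul_ldom i -> mul_rdom j ->
  mul_lfun i * Rbar_pi j = Rbar_pi i * mul_rfun j.
Proof.
move=> [ui [y vy ey]] [vj [k uk ek]].
rewrite (mul_lfunE vy ey) (mul_rfunE uk ek).
by rewrite compatible // ey -compatible // ek.
Qed.

Definition pair_mul : compatible_pair :=
  CompatiblePair mul_ldomP mul_lfunP mul_rdomP mul_rfunP mul_compatible.

End Ops.

Fact can_lfunP r : left_hom_on Rbar_pi setT (fun x => Rbar_pi (x * r)).
Proof. exact: (mulr_hom Rbar_piD Rbar_piM). Qed.

Fact can_rfunP r : right_hom_on Rbar_pi setT (fun x => Rbar_pi (r * x)).
Proof. exact: (@mulr_hom R^c Rbar^c _ Rbar_piD Rbar_piM_c). Qed.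

Fact can_compatible r i j : setT i -> setT j ->
  Rbar_pi (i * r) * Rbar_pi j = Rbar_pi i * Rbar_pi (r * j).
Proof. by move=> _ _; rewrite -!Rbar_piM mulrA. Qed.

Definition pair_of (r : R) : compatible_pair :=
  CompatiblePair (gab_setT Gl) (can_lfunP r) (gab_setT Gr') (can_rfunP r)
    (@can_compatible r).

Definition symquot_can (r : R) : symquot := \pi_symquot (pair_of r).

Definition symquot_add (x y : symquot) : symquot :=
  \pi_symquot (pair_add (repr x) (repr y)).
Definition symquot_opp (x : symquot) : symquot :=
  \pi_symquot (pair_opp (repr x)).
Definition symquot_mul (x y : symquot) : symquot :=
  \pi_symquot (pair_mul (repr x) (repr y)).

Lemma symquot_addE u v :
  symquot_add (\pi_symquot u) (\pi_symquot v) = \pi_symquot (pair_add u v).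
Proof.
have [hu hu'] := symquot_reprP u; have [hv hv'] := symquot_reprP v.
apply/symquotP; split; first exact: (agree_add Gl).
exact: (agree_add Gr').
Qed.

Lemma symquot_oppE u :
  symquot_opp (\pi_symquot u) = \pi_symquot (pair_opp u).
Proof.
have [hu hu'] := symquot_reprP u.
by apply/symquotP; split; apply: agree_opp.
Qed.

Lemma symquot_mulE u v :
  symquot_mul (\pi_symquot u) (\pi_symquot v) = \pi_symquot (pair_mul u v).
Proof.
have [hu hu'] := symquot_reprP u; have [hv hv'] := symquot_reprP v.
apply/symquotP; split.
  apply: (agree_comp Rbar_piD Rbar_piM Rbar_pi1 Rbar_pi_surj Gl) => //;
    by [apply: ldomP|apply: lfunP|apply: lfun_kills].
by apply: (@agree_comp R^c Rbar^c _ Rbar_piD Rbar_piM_c Rbar_pi1 Rbar_pi_surj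
   _ Gr') => //; [apply: rdomP|apply: rdomP|apply: rfun_kills|apply: rdomP
                 |apply: rfun_kills].
Qed.

Let symquotE := (symquot_addE, symquot_oppE, symquot_mulE).

Lemma symquot_ind (P : symquot -> Prop) :
  (forall u, P (\pi_symquot u)) -> forall x, P x.
Proof. by move=> h x; rewrite -[x]reprK; apply: h. Qed.

Lemma symquot_eq u v :
  (forall x, ldom u x -> ldom v x -> lfun u x = lfun v x) ->
  (forall x, rdom u x -> rdom v x -> rfun u x = rfun v x) ->
  \pi_symquot u = \pi_symquot v.
Proof.
move=> hl hr; apply/symquotP; split.
  exact: (agree_on Gl (ldomP u) (ldomP v) hl).
exact: (agree_on Gr' (rdomP u) (rdomP v) hr).
Qed.

Fact symquot_addA : associative symquot_add.
Proof.
elim/symquot_ind=> u; elim/symquot_ind=> v; elim/symquot_ind=> w.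
by rewrite !symquotE; apply: symquot_eq => x _ _ /=; rewrite addrA.
Qed.
Fact symquot_addC : commutative symquot_add.
Proof.
elim/symquot_ind=> u; elim/symquot_ind=> v.
by rewrite !symquotE; apply: symquot_eq => x _ _ /=; rewrite addrC.
Qed.
Fact symquot_add0 : left_id (symquot_can 0) symquot_add.
Proof.
elim/symquot_ind=> u; rewrite !symquotE.
by apply: symquot_eq => x _ _ /=; rewrite ?mulr0 ?mul0r add0r.
Qed.
Fact symquot_addN : left_inverse (symquot_can 0) symquot_opp symquot_add.
Proof.
elim/symquot_ind=> u; rewrite !symquotE.
by apply: symquot_eq => x _ _ /=; rewrite ?mulr0 ?mul0r addNr.
Qed.

HB.instance Definition _ := GRing.isZmodule.Build symquot
  symquot_addA symquot_addC symquot_add0 symquot_addN.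

Fact symquot_mulA : associative symquot_mul.
Proof.
elim/symquot_ind=> u; elim/symquot_ind=> v; elim/symquot_ind=> w.
rewrite !symquotE; apply/symquotP; split.
  apply: (comp_assoc Rbar_piD Rbar_piM Rbar_pi1 Rbar_pi_surj Gl);
    by [apply: ldomP|apply: lfunP|apply: lfun_kills
       |apply: (@lfun_kills (pair_mul v w))].
apply: agree_sym.
apply: (@comp_assoc R^c Rbar^c _ Rbar_piD Rbar_piM_c Rbar_pi1 Rbar_pi_surj
  _ Gr'); by [apply: rdomP|apply: rfunP'|apply: rfun_kills
             |apply: (@rfun_kills (pair_mul u v))].
Qed.

Fact symquot_mul1 : left_id (symquot_can 1) symquot_mul.
Proof.
elim/symquot_ind=> u; rewrite !symquotE; apply/symquotP; split.
  apply: (comp_1l Rbar_piD Rbar_piM Rbar_pi1 Rbar_pi_surj Gl);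
    by [apply: ldomP|apply: lfunP|apply: lfun_kills].
apply: (@comp_1r R^c Rbar^c _ Rbar_piD Rbar_piM_c Rbar_pi1 Rbar_pi_surj
  _ Gr'); by [apply: rdomP|apply: rfunP'].
Qed.

Fact symquot_mulr1 : right_id (symquot_can 1) symquot_mul.
Proof.
elim/symquot_ind=> u; rewrite !symquotE; apply/symquotP; split.
  apply: (comp_1r Rbar_piD Rbar_piM Rbar_pi1 Rbar_pi_surj Gl);
    by [apply: ldomP|apply: lfunP].
apply: (@comp_1l R^c Rbar^c _ Rbar_piD Rbar_piM_c Rbar_pi1 Rbar_pi_surj
  _ Gr'); by [apply: rdomP|apply: rfunP'|apply: rfun_kills].
Qed.

Fact symquot_mulDl : left_distributive symquot_mul symquot_add.
Proof.
elim/symquot_ind=> u; elim/symquot_ind=> v; elim/symquot_ind=> w.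
rewrite !symquotE; apply/symquotP; split.
  apply: (comp_addl Rbar_piD Rbar_piM Rbar_pi1 Rbar_pi_surj Gl);
    by [apply: ldomP|apply: lfunP|apply: lfun_kills].
apply: (@comp_addr R^c Rbar^c _ Rbar_piD Rbar_piM_c Rbar_pi1 Rbar_pi_surj
  _ Gr'); by [apply: rdomP|apply: rfunP'|apply: rfun_kills].
Qed.

Fact symquot_mulDr : right_distributive symquot_mul symquot_add.
Proof.
elim/symquot_ind=> u; elim/symquot_ind=> v; elim/symquot_ind=> w.
rewrite !symquotE; apply/symquotP; split.
  apply: (comp_addr Rbar_piD Rbar_piM Rbar_pi1 Rbar_pi_surj Gl);
    by [apply: ldomP|apply: lfunP|apply: lfun_kills].
apply: (@comp_addl R^c Rbar^c _ Rbar_piD Rbar_piM_c Rbar_pi1 Rbar_pi_surj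
  _ Gr'); by [apply: rdomP|apply: rfunP'|apply: rfun_kills].
Qed.

HB.instance Definition _ := GRing.Zmodule_isPzRing.Build symquot
  symquot_mulA symquot_mul1 symquot_mulr1 symquot_mulDl symquot_mulDr.

Lemma symquot_can_ker r : symquot_can r = 0 <-> torsion r.
Proof.
split=> [/symquotP[[I FI [_ hI]] [J FJ [_ hJ]]]|/Rbar_pi_eq0 r0].
  apply/Rbar_pi_eq0; apply: (Rbar_torsion_free FI FJ) => [i /hI|j /hJ] /=.
    by rewrite mulr0 Rbar_piM.
  by rewrite mul0r Rbar_piM.
by apply: symquot_eq => x _ _ /=; rewrite !Rbar_piM r0.
Qed.

End Quotients.

(* Main.v *)
Require Import Defs.
From HB Require Import structures.
From mathcomp Require Import all_boot all_algebra generic_quotient.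
From mathcomp Require Import boolp classical_sets.

(* The library of vector spaces also exports an lfun. *)
Import Defs.

Import GRing.Theory.
Local Open Scope classical_set_scope.
Local Open Scope ring_scope.
Local Open Scope quotient_scope.

Set Implicit Arguments.
Unset Strict Implicit.
Unset Printing Implicit Defensive.

(** All three conditions say that S is, on both sides, a ring of fractions of
    R in a localized sense.  Call [left_fractions f] the left half of the third
    condition: for every s the left ideal of the r with f(r) s in f(R) extends
    to the unit left ideal of S, that is, belongs to the left filter, and so
    does the left annihilator of every element of the kernel of f.  The third
    condition is the conjunction of this property for f and for its opposite
    R^c -> S^c ([left_filterP] turns membership in the filter into finite
    sums).  It remains to compare the other two conditions with it.

    Rings of quotients.  Under [left_fractions f] the filter is a Gabriel
    filter ([left_fractions_gabriel]); the point is stability under (I : r),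
    for which one clears the denominators of the coefficients f(r) s_k in
    f(r) = \sum_k f(r) s_k f(i_k).  The torsion elements are then those of
    the kernel of f, so R modulo torsion embeds into S, and each s in S yields
    the compatible pair of its right and left multiplications, restricted to
    the left and right denominators of s.  Conversely a compatible pair (a, b)
    is given by the multiplications by s = \sum_k t_k a(i_k), where
    1 = \sum_k t_k f(i_k) ([represents_surj]); so S is the symmetric quotient
    ([fractions_iso]).  In the other direction, if S is the symmetric quotient,
    the domains of a pair representing s consist of denominators of s, and
    elements of the kernel of f are torsion ([iso_left_fractions],
    [iso_right_fractions]).

    Flat epimorphisms.  [left_fractions f] is equivalent to: f is an
    epimorphism and S is flat as a right R-module.  If it holds, an equality
    in S (x)_R N can be tested on numerators over a common denominator, up to
    the filter, and numerators are computed in N; this gives flatness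
    ([left_fractions_flat]).  If f is an epimorphism, then s (x) 1 = 1 (x) s in
    S (x)_R S ([epimorphism_tensor]).  By flatness this equality descends to
    S (x)_R (f(R) + f(R) s), where it forces 1 to lie in S f(I) for the ideal I
    of left denominators of s; likewise 1 (x) a = 0 in S (x)_R R, for a in the
    kernel of f, descends to S (x)_R R a ([flat_transporter],
    [epimorphism_flat_fractions]).  Flatness of S on the left is flatness on
    the right over the opposite rings ([flat_left_converse]). *)

(** * Left ideals extending to the unit ideal *)

Section LeftFilter.
Variables (R S : pzRingType) (f : {rmorphism R -> S}).
Implicit Types (I J : set R) (X : set S).

Lemma left_filter_ind I X : left_filter f I -> left_ideal X ->
  (forall x, I x -> X (f x)) -> forall s, X s.
Proof.
move=> [_ eI] hX IX s.
have : smallest (@left_ideal S) (f @` I) s by rewrite eI.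
by move/(_ X); apply; split=> // _ [x /IX Xx <-].
Qed.

Lemma left_filter_intro I : left_ideal I ->
  (forall X, left_ideal X -> (forall x, I x -> X (f x)) -> X 1) ->
  left_filter f I.
Proof.
move=> hI h; split=> //; apply/seteqP; split=> // s _ X [hX IX].
case: (hX) => _ _ XM; rewrite -[s]mulr1; apply/XM/(h X hX) => x Ix.
by apply: IX; exists x.
Qed.

Lemma left_filterP I : left_ideal I ->
  left_filter f I <->
  exists (n : nat) (r : 'I_n -> R) (t : 'I_n -> S),
    (forall i, I (r i)) /\ \sum_(i < n) t i * f (r i) = 1.
Proof.
move=> hI; split=> [FI|[n [r [t [Ir e]]]]]; last first.
  apply: left_filter_intro => // X [X0 XD XM] IX; rewrite -e.
  by apply: (big_ind X) => // i _; apply/XM/IX.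
pose X := [set s | exists (n : nat) (r : 'I_n -> R) (t : 'I_n -> S),
  (forall i, I (r i)) /\ \sum_(i < n) t i * f (r i) = s].
apply: (left_filter_ind (X := X) FI) => [|x Ix]; last first.
  by exists 1%N, (fun=> x), (fun=> 1); rewrite big_ord1 mul1r.
split.
- by exists 0%N, (fun=> 0), (fun=> 0); split=> [[]//|]; rewrite big_ord0.
- move=> _ _ [n [r [t [Ir <-]]]] [m [r' [t' [Ir' <-]]]].
  pose cat T (a : 'I_n -> T) (b : 'I_m -> T) (i : 'I_(n + m)) :=
    match split i with inl j => a j | inr k => b k end.
  exists (n + m)%N, (cat R r r'), (cat S t t'); split=> [i|].
    by rewrite /cat; case: split.
  rewrite big_split_ord; congr (_ + _); apply: eq_bigr => i _; rewrite /cat.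
    by rewrite -[lshift m i]/(unsplit (inl i)) unsplitK.
  by rewrite -[rshift n i]/(unsplit (inr i)) unsplitK.
- move=> s _ [n [r [t [Ir <-]]]]; exists n, r, (fun i => s * t i); split=> //.
  by rewrite mulr_sumr; apply: eq_bigr => i _; rewrite mulrA.
Qed.

Lemma left_filter_up I J : left_filter f I -> left_ideal J -> I `<=` J ->
  left_filter f J.
Proof.
move=> FI hJ IJ; apply: left_filter_intro => // X hX JX.
by apply: (left_filter_ind FI hX) => x /IJ/JX.
Qed.

Lemma left_filter_setT : left_filter f setT.
Proof.
apply: left_filter_intro => [|X _ TX]; first by split.
by rewrite -(rmorph1 f); apply: TX.
Qed.

Lemma left_ideal_colon I r : left_ideal I -> left_ideal [set x | I (x * r)].
Proof.
move=> [I0 ID IM]; split=> [|x y|s x] /=; first by rewrite mul0r.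
  by rewrite mulrDl; apply: ID.
by rewrite -mulrA; apply: IM.
Qed.

Lemma left_idealI I J : left_ideal I -> left_ideal J -> left_ideal (I `&` J).
Proof.
move=> [I0 ID IM] [J0 JD JM]; split=> // [x y [? ?] [? ?]|r x [? ?]].
  by split; [exact: ID|exact: JD].
by split; [exact: IM|exact: JM].
Qed.

(** If 1 is a combination of the f x with x in J, and each 1 of the f y with
    y x in I, then substituting the latter combinations into the former one
    writes 1 with the f (y x). *)
Lemma left_filter_local I J : left_ideal I -> left_filter f J ->
  (forall x, J x -> left_filter f [set y | I (y * x)]) -> left_filter f I.
Proof.
move=> hI FJ h; apply: left_filter_intro => // X hX IX.
case: (hX) => X0 XD XM.
apply: (left_filter_ind FJ hX) => x Jx; rewrite -[f x]mul1r.
pose Y := [set s | X (s * f x)].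
apply: (left_filter_ind (X := Y) (h x Jx)) => [|y Ixy]; rewrite /Y /=.
  split=> [|s t|s t] /=; first by rewrite mul0r.
    by rewrite mulrDl; apply: XD.
  by rewrite -mulrA; apply: XM.
by rewrite -rmorphM; apply: IX.
Qed.

Lemma left_filter_cancel I s : left_filter f I ->
  (forall x, I x -> f x * s = 0) -> s = 0.
Proof.
move=> FI h; rewrite -[s]mul1r.
apply: (left_filter_ind (X := [set t | t * s = 0]) FI) => //.
split=> [|x y /= ex ey|r x /= ex] /=; first by rewrite mul0r.
  by rewrite mulrDl ex ey addr0.
by rewrite -mulrA ex mulr0.
Qed.

Definition left_transporter (A : set S) (s : S) : set R :=
  [set x | A (f x * s)].

Definition left_annihilator (a : R) : set R := [set x | x * a = 0].

(** The left half of the third condition: fractions f(r)^-1 f(x) on the left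
    exhaust S, in the localized sense that r runs over a family generating
    the unit left ideal, and elements of the kernel of f are killed by such
    a family. *)
Definition left_fractions :=
  (forall s, left_filter f (left_transporter (range f) s)) /\
  (forall a, f a = 0 -> left_filter f (left_annihilator a)).

Lemma left_transporter_ideal I s : left_ideal I ->
  left_ideal (left_transporter (f @` I) s).
Proof.
move=> [I0 ID IM]; split=> [|x y [i Ii ei] [j Ij ej]|r x [i Ii ei]].
- by exists 0; rewrite // !rmorph0 mul0r.
- by exists (i + j); [exact: ID|rewrite !rmorphD ei ej mulrDl].
- by exists (r * i); [exact: IM|rewrite !rmorphM ei mulrA].
Qed.

Lemma left_annihilator_ideal a : left_ideal (left_annihilator a).
Proof.
rewrite /left_annihilator; split=> [|x y /= ex ey|r x /= ex] /=.
- by rewrite mul0r.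
- by rewrite mulrDl ex ey addr0.
- by rewrite -mulrA ex mulr0.
Qed.

Hypothesis LF : left_fractions.

(** The elements s all of whose left multiples are transported into f(I) by
    a member of the filter form a left ideal of S containing f(I), so they
    are all of S. *)
Lemma left_filter_transporter I s : left_filter f I ->
  left_filter f (left_transporter (f @` I) s).
Proof.
move=> FI; have hI : left_ideal I by case: FI.
pose X := [set s | forall u, left_filter f (left_transporter (f @` I) (u * s))].
suff Xs : X s by have := Xs 1; rewrite mul1r.
apply: (left_filter_ind (X := X) FI) => [|x Ix]; last first.
  move=> u; apply: left_filter_up (LF.1 u) (left_transporter_ideal _ hI) _.
  move=> y [r _ er]; exists (r * x); first by case: hI => _ _; apply.
  by rewrite rmorphM er mulrA.
split=> [u|s1 s2 X1 X2 u|r s1 X1 u]; last by rewrite mulrA.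
  apply: left_filter_up left_filter_setT (left_transporter_ideal _ hI) _.
  by move=> y _; exists 0; [case: hI|rewrite rmorph0 !mulr0].
apply: (left_filter_local (left_transporter_ideal _ hI) (X1 u)).
move=> x [i Ii ei]; apply: left_filter_up (X2 (f x * u)) _ _.
  exact/left_ideal_colon/left_transporter_ideal.
move=> y [j Ij ej]; case: hI => _ ID IM.
exists (y * i + j); first by apply: ID => //; apply: IM.
by rewrite rmorphD !rmorphM ei ej mulrDr mulrDr !mulrA.
Qed.

(** If f(x r) = f(i) with i in I, then x r - i lies in the kernel of f, so a
    member of the filter multiplies x r into I; the x in question form a
    member of the filter themselves. *)
Lemma left_filter_colon I r : left_filter f I ->
  left_filter f [set x | I (x * r)].
Proof.
move=> FI; have hI : left_ideal I by case: FI.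
apply: (left_filter_local (left_ideal_colon r hI)
         (left_filter_transporter (f r) FI)) => x [i Ii ei].
have xri : f (x * r - i) = 0 by rewrite rmorphB rmorphM ei subrr.
apply: left_filter_up (LF.2 _ xri) _ _.
  exact/left_ideal_colon/left_ideal_colon.
move=> y; rewrite /left_annihilator /= mulrBr => /eqP; rewrite subr_eq0 => /eqP.
by rewrite mulrA => ->; case: hI => _ _; apply.
Qed.

Lemma left_filterI I J : left_filter f I -> left_filter f J ->
  left_filter f (I `&` J).
Proof.
move=> FI FJ; have hI : left_ideal I by case: FI.
have hJ : left_ideal J by case: FJ.
apply: (left_filter_local (left_idealI hI hJ) FI) => x Ix.
apply: left_filter_up (left_filter_colon x FJ) _ _.
  exact/left_ideal_colon/left_idealI.
by move=> y Jyx; split=> //; case: hI => _ _; apply.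
Qed.

Lemma left_fractions_gabriel : left_gabriel_filter (left_filter f).
Proof.
split; first by exists setT; apply: left_filter_setT.
split.
- by move=> I [].
- exact: left_filter_up.
- exact: left_filterI.
- exact: left_filter_colon.
- exact: left_filter_local.
Qed.

(** If g and h agree on f(R), then g(f x) (g s - h s) = 0 whenever f(x) s is in
    f(R), and such x generate the unit left ideal. *)
Lemma left_fractions_epimorphism : ring_epimorphism f.
Proof.
move=> T g h gh s.
apply/eqP; rewrite -subr_eq0 -[_ - _]mul1r -(rmorph1 g); apply/eqP.
apply: (left_filter_ind (X := [set t | g t * (g s - h s) = 0]) (LF.1 s)).
  split=> [|x y /= ex ey|r x /= ex] /=.
  - by rewrite rmorph0 mul0r.
  - by rewrite rmorphD mulrDl ex ey addr0.
  - by rewrite rmorphM -mulrA ex mulr0.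
move=> x [y _ ey] /=.
rewrite mulrBr -[X in _ - X * _]/((g \o f) x) [X in _ - X * _]gh /=.
by rewrite -!rmorphM -ey -[X in _ - X]/((h \o f) y) -gh subrr.
Qed.

End LeftFilter.

(** * Opposite rings *)

Section Converse.
Variables (R S : pzRingType) (f : {rmorphism R -> S}).

Definition converse_map : R^c -> S^c := f.

Fact converse_map_additive : zmod_morphism converse_map.
Proof. exact: (rmorphB f). Qed.
Fact converse_map_multiplicative : monoid_morphism converse_map.
Proof. by split=> [|x y]; [exact: (rmorph1 f)|exact: (rmorphM f)]. Qed.

HB.instance Definition _ := GRing.isZmodMorphism.Build R^c S^c converse_map
  converse_map_additive.
HB.instance Definition _ := GRing.isMonoidMorphism.Build R^c S^c converse_map
  converse_map_multiplicative.

(** Right ideals of R are left ideals of R^c, by conversion, so [right_filter f]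
    is [left_filter converse], and facts about the left filter of a ring
    homomorphism apply to it. *)
Definition converse : {rmorphism R^c -> S^c} := converse_map.

End Converse.

(** * Fractions and the symmetric ring of quotients *)

Section SymmetricQuotient.
Variables (R S : pzRingType) (f : {rmorphism R -> S}).
Hypotheses (Gl : left_gabriel_filter (left_filter f))
           (Gr : right_gabriel_filter (right_filter f)).

Local Notation Q := (symquot Gl Gr).
Local Notation pair := (compatible_pair Gl Gr).
Local Notation "'pi" := (Rbar_pi Gl Gr).
Local Notation torsion := (torsion (left_filter f) (right_filter f)).

Lemma right_filter_cancel J s : right_filter f J ->
  (forall x, J x -> s * f x = 0) -> s = 0.
Proof. exact: (@left_filter_cancel R^c S^c (converse f)). Qed.

(** If g f is the canonical map, then for i in the domain of the first
    component a of g s, right multiplication by i followed by a is right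
    multiplication by a(i), which says that g (f i * s) = g (f r) for any
    representative r of a(i).  So f(i) s lies in f(R). *)
Lemma iso_left_fractions (g : {rmorphism S -> Q}) : injective g ->
  g \o f =1 symquot_can Gl Gr -> left_fractions f.
Proof.
move=> g_inj gf; split=> [s|a fa0]; last first.
  have /symquot_can_ker[[I FI hI] _] : symquot_can Gl Gr a = 0.
    by rewrite -gf /= fa0 rmorph0.
  exact: left_filter_up FI (left_annihilator_ideal _) hI.
rewrite /left_transporter; pose u := repr (g s).
apply: left_filter_up (ldomP u) _ _ => [|i Ii].
  have e : range f = f @` setT by [].
  by rewrite e; apply: left_transporter_ideal.
have [r er] := Rbar_pi_surj (lfun u i).
exists r => //; apply: g_inj; rewrite rmorphM -[g (f r)]/((g \o f) r) gf.
rewrite -[g (f i)]/((g \o f) i) gf -[g s]reprK -/u.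
rewrite -[RHS]/(symquot_mul _ _) symquot_mulE; apply: symquot_eq.
  move=> x _ [_ [y uy ey]] /=.
  have -> : mul_lfun (pair_of Gl Gr i) u x = lfun u (x * i).
    apply: mul_lfunE => //.
    by case: (gab_ideal Gl (ldomP u)) => _ _; apply.
  by case: (lfunP u) => _ -> //; rewrite Rbar_piM er.
move=> y _ [uy [z _ ez]].
rewrite [RHS](@mul_rfunE _ _ _ _ _ (pair_of Gl Gr i) u y z) //=.
by rewrite !Rbar_piM er ez compatible.
Qed.

(** As before, with the second component of g s; the symmetric quotient of
    R^c is not convertible to that of R, so the argument is repeated. *)
Lemma iso_right_fractions (g : {rmorphism S -> Q}) : injective g ->
  g \o f =1 symquot_can Gl Gr -> left_fractions (converse f).
Proof.
move=> g_inj gf; split=> [s|a fa0]; last first.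
  have /symquot_can_ker[_ [I FI hI]] : symquot_can Gl Gr a = 0.
    by rewrite -gf /= [f a]fa0 rmorph0.
  exact: (@left_filter_up _ _ (converse f) _ _ FI
    (left_annihilator_ideal _) hI).
rewrite /left_transporter; pose u := repr (g s).
apply: (@left_filter_up _ _ (converse f) _ _ (rdomP u)) => [|j Jj].
  have e : range (converse f) = converse f @` setT by [].
  by rewrite e; apply: left_transporter_ideal.
have [r er] := Rbar_pi_surj (rfun u j).
exists r => //; apply: g_inj; rewrite -[g (_ r)]/((g \o f) r) gf.
rewrite -[_ * _]/((s : S) * f j) rmorphM -[g (f j)]/((g \o f) j) gf.
rewrite -[g s]reprK -/u.
rewrite -[RHS]/(symquot_mul _ _) symquot_mulE; apply: symquot_eq.
  move=> y _ [uy [z _ ez]].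
  rewrite [RHS](@mul_lfunE _ _ _ _ _ u (pair_of Gl Gr j) y z) //=.
  by rewrite !Rbar_piM er ez compatible.
move=> x _ [_ [y uy ey]] /=.
have -> : mul_rfun u (pair_of Gl Gr j) x = rfun u ((j : R) * x).
  by apply: mul_rfunE => //; have [[_ _ JM] _] := rdomP u; apply: JM.
by case: (rfunP u) => _ -> //; rewrite Rbar_piM er.
Qed.

Lemma torsion_f0 a : torsion a -> f a = 0.
Proof.
case=> [[I FI Ia] _]; apply: (left_filter_cancel FI) => x /Ia.
by rewrite -rmorphM => ->; rewrite rmorph0.
Qed.

Hypotheses (Ll : left_fractions f) (Lr : left_fractions (converse f)).

(** Independent of the representative, as f vanishes on torsion elements. *)
Definition Rbar_map (q : Rbar Gl Gr) : S := f (repr q).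

Lemma Rbar_map_pi r : Rbar_map ('pi r) = f r.
Proof.
by apply/eqP; rewrite -subr_eq0 -rmorphB; apply/eqP/torsion_f0/Rbar_reprP.
Qed.

Lemma Rbar_map_inj : injective Rbar_map.
Proof.
move=> p q; have [x <-] := Rbar_pi_surj p; have [y <-] := Rbar_pi_surj q.
rewrite !Rbar_map_pi => e.
have xy : f (x - y) = 0 by rewrite rmorphB e subrr.
apply/Rbar_piP; split.
  by exists (left_annihilator (x - y)); first exact: (Ll.2 _ xy).
by exists (left_annihilator ((x - y) : R^c)); first exact: (Lr.2 _ xy).
Qed.

Lemma Rbar_mapM p q : Rbar_map (p * q) = Rbar_map p * Rbar_map q.
Proof.
have [x <-] := Rbar_pi_surj p; have [y <-] := Rbar_pi_surj q.
by rewrite -Rbar_piM !Rbar_map_pi rmorphM.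
Qed.

Lemma Rbar_mapD p q : Rbar_map (p + q) = Rbar_map p + Rbar_map q.
Proof.
have [x <-] := Rbar_pi_surj p; have [y <-] := Rbar_pi_surj q.
by rewrite -Rbar_piD !Rbar_map_pi rmorphD.
Qed.

(** The pair u acts, through the embedding of R / ker f into S, as the two
    multiplications by s. *)
Definition represents (u : pair) (s : S) :=
  (forall i, ldom u i -> Rbar_map (lfun u i) = f i * s) /\
  (forall j, rdom u j -> Rbar_map (rfun u j) = s * f j).

Lemma represents_eq u v s : represents u s -> represents v s ->
  \pi_Q u = \pi_Q v.
Proof.
move=> [ul ur] [vl vr]; apply: symquot_eq => x ux vx; apply: Rbar_map_inj.
  by rewrite ul // vl.
by rewrite ur // vr.
Qed.

Lemma represents_inj u v s t : represents u s -> represents v t ->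
  \pi_Q u = \pi_Q v -> s = t.
Proof.
move=> [ul _] [vl _] /symquotP[[K FK [Kuv Ke]] _].
apply/eqP; rewrite -subr_eq0; apply/eqP/(left_filter_cancel FK) => x Kx.
by have [ux vx] := Kuv _ Kx; rewrite mulrBr -ul // -vl // Ke // subrr.
Qed.

Lemma represents_add u v s t : represents u s -> represents v t ->
  represents (pair_add u v) (s + t).
Proof.
move=> [ul ur] [vl vr]; split=> x [ux vx] /=.
  by rewrite Rbar_mapD ul // vl // mulrDr.
by rewrite Rbar_mapD ur // vr // mulrDl.
Qed.

Lemma represents_mul u v s t : represents u s -> represents v t ->
  represents (pair_mul u v) (s * t).
Proof.
move=> [ul ur] [vl vr]; split=> x [ux [y vy ey]].
  by rewrite [lfun _ _](mul_lfunE vy ey) vl // -Rbar_map_pi ey ul // mulrA.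
by rewrite [rfun _ _](mul_rfunE vy ey) ur // -Rbar_map_pi ey vr // mulrA.
Qed.

Lemma represents_can r : represents (pair_of Gl Gr r) (f r).
Proof. by split=> x _ /=; rewrite Rbar_map_pi rmorphM. Qed.

(** The domains are the left and the right denominators of s. *)
Lemma represents_exists s : exists u, represents u s.
Proof.
pose I := left_transporter f (range f) s.
pose J : set R :=
  left_transporter (converse f) (range (converse f)) s.
have FI : left_filter f I by exact: Ll.1.
have FJ : right_filter f J by exact: Lr.1.
pose a x := 'pi (xget 0 [set r | f r = f x * s]).
pose b (x : R) := 'pi (xget 0 [set r | f r = s * f x]).
have aE x : I x -> Rbar_map (a x) = f x * s.
  by case=> r _ er; rewrite Rbar_map_pi; case: xgetP => [y _ -> //|/(_ r)].
have bE x : J x -> Rbar_map (b x) = s * f x.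
  by case=> r _ er; rewrite Rbar_map_pi; case: xgetP => [y _ -> //|/(_ r)].
have [_ ID IM] : left_ideal I by exact: FI.1.
have [_ JD JM] : right_ideal J by exact: FJ.1.
have ha : left_hom_on 'pi I a.
  split=> [x y Ix Iy|r x Ix]; apply: Rbar_map_inj.
    by rewrite Rbar_mapD !aE // ?rmorphD ?mulrDl //; apply: ID.
  by rewrite Rbar_mapM Rbar_map_pi !aE // ?rmorphM ?mulrA //; apply: IM.
have hb : right_hom_on 'pi J b.
  split=> [x y Jx Jy|r x Jx]; apply: Rbar_map_inj.
    by rewrite Rbar_mapD !bE // ?rmorphD ?mulrDr //; apply: JD.
  by rewrite Rbar_mapM Rbar_map_pi !bE // ?rmorphM ?mulrA //; apply: JM.
have ab i j : I i -> J j -> a i * 'pi j = 'pi i * b j.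
  move=> Ii Jj; apply: Rbar_map_inj.
  by rewrite !Rbar_mapM aE // bE // !Rbar_map_pi mulrA.
by exists (CompatiblePair FI ha FJ hb ab).
Qed.

(** Writing 1 = \sum_k t_k f(i_k) with the i_k in the domain of a forces
    s = \sum_k t_k a(i_k).  Compatibility says that s f(j) = b(j) for j in the
    domain of b, and f(i) s = a(i) follows by cancelling these f(j). *)
Lemma represents_surj u : exists s, represents u s.
Proof.
have hI : left_ideal (ldom u) by case: (ldomP u).
have [n [x [t [Ix e]]]] := (left_filterP f hI).1 (ldomP u).
pose s := \sum_(k < n) t k * Rbar_map (lfun u (x k)).
have sE j : rdom u j -> Rbar_map (rfun u j) = s * f j.
  move=> Jj; rewrite /s mulr_suml -[LHS]mul1r -e mulr_suml.
  apply: eq_bigr => k _; rewrite -!mulrA -(Rbar_map_pi j) -Rbar_mapM.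
  by rewrite compatible // Rbar_mapM Rbar_map_pi.
exists s; split=> // i Ii; apply/eqP; rewrite -subr_eq0; apply/eqP.
apply: (right_filter_cancel (rdomP u)) => j Jj.
rewrite mulrBl -mulrA -sE // -(Rbar_map_pi j) -(Rbar_map_pi i) -!Rbar_mapM.
by rewrite compatible // subrr.
Qed.

Lemma fractions_iso : exists g : {rmorphism S -> Q},
  bijective g /\ g \o f =1 symquot_can Gl Gr.
Proof.
pose g0 s : Q := \pi_Q (xget (pair_of Gl Gr 0) [set u | represents u s]).
have g0E u s : represents u s -> g0 s = \pi_Q u.
  rewrite /g0; case: xgetP => [v _ vs us|/(_ u)//].
  exact: represents_eq vs us.
have g0can r : g0 (f r) = symquot_can Gl Gr r.
  exact: g0E (represents_can r).
have g0D : {morph g0 : s t / s + t}.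
  move=> s t; have [u us] := represents_exists s.
  have [v vt] := represents_exists t.
  rewrite (g0E _ _ us) (g0E _ _ vt) (g0E _ _ (represents_add us vt)).
  by rewrite -[RHS]/(symquot_add _ _) symquot_addE.
have g0M : {morph g0 : s t / s * t}.
  move=> s t; have [u us] := represents_exists s.
  have [v vt] := represents_exists t.
  rewrite (g0E _ _ us) (g0E _ _ vt) (g0E _ _ (represents_mul us vt)).
  by rewrite -[RHS]/(symquot_mul _ _) symquot_mulE.
have g0B : zmod_morphism g0.
  by move=> s t; apply/eqP; rewrite eq_sym subr_eq -g0D subrK.
have g01 : monoid_morphism g0 by split=> //; rewrite -(rmorph1 f) g0can.
pose g : {rmorphism S -> Q} := HB.pack g0
  (GRing.isZmodMorphism.Build _ _ g0 g0B)
  (GRing.isMonoidMorphism.Build _ _ g0 g01).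
have g_inj : injective g.
  move=> s t /=; have [u us] := represents_exists s.
  have [v vt] := represents_exists t.
  by rewrite (g0E _ _ us) (g0E _ _ vt); apply: represents_inj.
have g_surj q : exists s, g s = q.
  elim/symquot_ind: q => u; have [s us] := represents_surj u.
  by exists s; apply: g0E.
exists g; split=> //; pose h q := xget 0 [set s | g s = q].
have gh q : g (h q) = q.
  by rewrite /h; have [s es] := g_surj q; case: xgetP => // /(_ s).
by exists h => // s; apply: g_inj; rewrite gh.
Qed.

End SymmetricQuotient.

(** * Tensor products *)

Section TensorSums.
Variables (R : pzRingType) (M : lmodType R^c) (N : lmodType R).
Implicit Types (x y : seq (M * N)).

Local Notation "m '*t' n" := (@pure_tensor R M N m n) (at level 40).

Lemma tensor_piE x : \pi_(tensor M N) x = \sum_(p <- x) p.1 *t p.2.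
Proof.
elim: x => [|[m n] x IHx]; first by rewrite big_nil.
by rewrite big_cons -IHx; apply: (tensor_pi_cat [:: (m, n)] x).
Qed.

Lemma pure_tensorDl m m' n : (m + m') *t n = m *t n + m' *t n.
Proof.
have /tensorP := tensor_addl m m' n.
by rewrite !tensor_piE !big_cons !big_nil !addr0.
Qed.

Lemma pure_tensorDr m n n' : m *t (n + n') = m *t n + m *t n'.
Proof.
have /tensorP := tensor_addr m n n'.
by rewrite !tensor_piE !big_cons !big_nil !addr0.
Qed.

Lemma pure_tensorZ m (r : R) n : ((r : R^c) *: m) *t n = m *t (r *: n).
Proof.
have /tensorP := tensor_balanced m r n.
by rewrite !tensor_piE !big_cons !big_nil !addr0.
Qed.

Lemma pure_tensor0l n : 0 *t n = 0.
Proof. by apply: (addrI (0 *t n)); rewrite -pure_tensorDl !addr0. Qed.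

Lemma pure_tensor0r m : m *t 0 = 0.
Proof. by apply: (addrI (m *t 0)); rewrite -pure_tensorDr !addr0. Qed.

End TensorSums.

Lemma tensor_map_injective (R : pzRingType) (M M' : lmodType R^c)
    (N N' : lmodType R) (u : {linear M -> M'}) (v : {linear N -> N'}) :
  injective (tensor_map u v) <->
  forall x y : seq (M * N),
    tensor_rel [seq (u p.1, v p.2) | p <- x] [seq (u p.1, v p.2) | p <- y] ->
    tensor_rel x y.
Proof.
split=> [inj x y /tensorP e|h].
  by apply/tensorP/inj; rewrite !tensor_map_pi.
elim/quotW=> x; elim/quotW=> y; rewrite !tensor_map_pi => /tensorP e.
exact/tensorP/h.
Qed.

Section TensorMapAdditive.
Variables (R : pzRingType) (M M' : lmodType R^c) (N N' : lmodType R).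
Variables (u : {linear M -> M'}) (v : {linear N -> N'}).

Lemma tensor_ind (P : tensor M N -> Prop) : P 0 ->
  (forall m n x, P x -> P (pure_tensor m n + x)) -> forall x, P x.
Proof.
move=> P0 PD; elim/quotW=> x; rewrite tensor_piE.
by elim: x => [|p x IHx]; rewrite ?big_nil ?big_cons //; apply: PD.
Qed.

Lemma tensor_mapD (x y : tensor M N) :
  tensor_map u v (x + y) = tensor_map u v x + tensor_map u v y.
Proof.
elim/quotW: x => x; elim/quotW: y => y.
rewrite -[_ x + _ y](tensor_pi_cat x y) !tensor_map_pi map_cat.
exact: tensor_pi_cat.
Qed.

Lemma tensor_map_pure m n :
  tensor_map u v (pure_tensor m n) = pure_tensor (u m) (v n).
Proof. exact: tensor_map_pi. Qed.

Lemma tensor_map0 : tensor_map u v 0 = 0.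
Proof.
apply: (addrI (tensor_map u v 0)).
by rewrite -tensor_mapD !addr0.
Qed.

End TensorMapAdditive.

Section Swap.
Variables (R R' : pzRingType) (c : R -> R').
Variables (M : lmodType R^c) (N : lmodType R).
Variables (M' : lmodType R'^c) (N' : lmodType R').
Variables (phi : {additive M -> N'}) (psi : {additive N -> M'}).
Hypotheses (phiZ : forall (r : R) m, phi ((r : R^c) *: m) = c r *: phi m)
           (psiZ : forall r n, psi (r *: n) = (c r : R'^c) *: psi n).

(** M (x)_R N is N (x)_(R^c) M.  The statement allows a different ring R' and
    different modules because the two R-actions on S, read over R^c, are
    equal to those obtained from the opposite of f only up to the proofs of
    the module axioms; c, phi and psi are then identities. *)
Lemma tensor_rel_swap x y : tensor_rel x y ->
  tensor_rel [seq (psi p.2, phi p.1) | p <- x]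
             [seq (psi p.2, phi p.1) | p <- y].
Proof.
elim=> {x y} /=.
- by move=> x; apply: tensor_refl.
- by move=> x y _; apply: tensor_sym.
- by move=> x y z _ xy _; apply: tensor_trans.
- by move=> x y x' y' _ hx _ hy; rewrite !map_cat; apply: tensor_cat.
- by move=> x y; rewrite !map_cat; apply: tensor_comm.
- move=> n; rewrite raddf0; apply/tensorP.
  by rewrite !tensor_piE big_cons !big_nil pure_tensor0r addr0.
- by move=> m m' n; rewrite raddfD; apply: tensor_addr.
- by move=> m n n'; rewrite raddfD; apply: tensor_addl.
- move=> m r n; rewrite phiZ psiZ.
  exact/tensor_sym/tensor_balanced.
Qed.

End Swap.

Section FlatConverse.
Variables (R S : pzRingType) (f : {rmorphism R -> S}).

Local Notation SL := (left_restr f).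
Local Notation SR := (right_restr (converse f)).

Lemma flat_left_converse : flat_left SL <-> flat_right SR.
Proof.
have swap (M : lmodType R^c) (x y : seq (M * SL)) : tensor_rel x y ->
    @tensor_rel R^c SR M [seq (p.2, p.1) | p <- x] [seq (p.2, p.1) | p <- y].
  exact: (@tensor_rel_swap R R^c id M SL SR M
    idfun (idfun : {additive S -> S})).
have unswap (M : lmodType R^c) (x y : seq (SR * M)) :
    @tensor_rel R^c SR M x y ->
    @tensor_rel R M SL [seq (p.2, p.1) | p <- x] [seq (p.2, p.1) | p <- y].
  exact: (@tensor_rel_swap R^c R id SR M M SL
    (idfun : {additive S -> S}) idfun).
have swapK (A B : Type) (x : seq (A * B)) :
    [seq (p.2, p.1) | p <- [seq (p.2, p.1) | p <- x]] = x.
  by elim: x => //= -[a b] x ->.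
split=> flat M M' u u_inj; apply/tensor_map_injective => x y.
  move=> /unswap; rewrite -!map_comp => h.
  have /tensor_map_injective inj := flat M M' u u_inj.
  rewrite -(swapK _ _ x) -(swapK _ _ y); apply/swap/inj.
  by rewrite -!map_comp.
move=> /swap; rewrite -!map_comp => h.
have /tensor_map_injective inj := flat M M' u u_inj.
rewrite -(swapK _ _ x) -(swapK _ _ y); apply/unswap/inj.
by rewrite -!map_comp.
Qed.

Lemma epimorphism_converse : ring_epimorphism f ->
  ring_epimorphism (converse f).
Proof.
move=> epi T g h gh.
have opp (k : {rmorphism S^c -> T}) : exists k' : {rmorphism S -> T^c},
    forall s, k' s = k s.
  pose k0 : S -> T^c := k.
  have kB : zmod_morphism k0 by exact: (rmorphB k).
  have kM : monoid_morphism k0.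
    by split=> [|x y]; [exact: (rmorph1 k)|exact: (rmorphM k)].
  pose k' : {rmorphism S -> T^c} := HB.pack k0
    (GRing.isZmodMorphism.Build _ _ k0 kB)
    (GRing.isMonoidMorphism.Build _ _ k0 kM).
  by exists k'.
have [g' g'E] := opp g; have [h' h'E] := opp h.
have gh' : g' \o f =1 h' \o f by move=> x /=; rewrite g'E h'E; apply: gh.
by move=> s; rewrite -g'E -h'E; apply: (epi T^c g' h' gh').
Qed.

End FlatConverse.

(** * Fractions are flat *)

Section FractionsFlat.
Variables (R S : pzRingType) (f : {rmorphism R -> S}).
Hypothesis LF : left_fractions f.

Local Notation SR := (right_restr f).
Local Notation F := (left_filter f).

Section Numerators.
Variable N : lmodType R.
Implicit Types (x y z : seq (SR * N)) (n : N) (i j : R).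

(** j is a common denominator of the first components of x, and n the
    resulting numerator of the element \sum_k s_k (x) n_k denoted by x, that
    is, an element with f(j) (\sum_k s_k (x) n_k) = 1 (x) n. *)
Fixpoint numerator x j n : Prop :=
  if x is (s, m) :: x' then
    exists r n', [/\ f r = f j * (s : S), numerator x' j n' & n = r *: m + n']
  else n = 0.

Lemma numerator0 x : numerator x 0 0.
Proof.
elim: x => //= -[s m] x IHx; exists 0, 0; split=> //.
  by rewrite !rmorph0 mul0r.
by rewrite scale0r addr0.
Qed.

Lemma numeratorD x i j m n : numerator x i m -> numerator x j n ->
  numerator x (i + j) (m + n).
Proof.
elim: x m n => [|[s k] x IHx] m n /=; first by move=> -> ->; rewrite addr0.
move=> [r [m' [er xm ->]]] [q [n' [eq xn ->]]].
exists (r + q), (m' + n'); split; last by rewrite scalerDl addrACA.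
  by rewrite !rmorphD mulrDl er eq.
exact: IHx.
Qed.

Lemma numeratorZ x r j n : numerator x j n -> numerator x (r * j) (r *: n).
Proof.
elim: x n => [|[s k] x IHx] n /=; first by move=> ->; rewrite scaler0.
move=> [q [n' [eq xn ->]]]; exists (r * q), (r *: n'); split.
- by rewrite !rmorphM eq mulrA.
- exact: IHx.
- by rewrite scalerDr scalerA.
Qed.

Lemma numerator_cat x y j m n : numerator x j m -> numerator y j n ->
  numerator (x ++ y) j (m + n).
Proof.
elim: x m => [|[s k] x IHx] m /=; first by move=> ->; rewrite add0r.
move=> [q [m' [eq xm ->]]] yn; exists q, (m' + n).
by rewrite -addrA; split=> //; apply: IHx.
Qed.

Lemma numerator_cat_split x y j n : numerator (x ++ y) j n ->
  exists n1 n2, [/\ numerator x j n1, numerator y j n2 & n = n1 + n2].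
Proof.
elim: x n => [|[s k] x IHx] n /=; first by exists 0, n; rewrite add0r.
move=> [q [n' [eq /IHx[n1 [n2 [xn1 yn2 ->]]] ->]]].
exists (q *: k + n1), n2; split=> //; last by rewrite addrA.
by exists q, n1.
Qed.

(** Numerators are not unique, as f need not be injective, but each element
    of the kernel of f is killed by a member of the filter. *)
Lemma numerator_torsion x n : numerator x 0 n -> F [set r | r *: n = 0].
Proof.
have ideal_ann (k : N) : left_ideal [set r : R | r *: k = 0].
  split=> [|a b /= ea eb|a b /= eb] /=; first by rewrite scale0r.
    by rewrite scalerDl ea eb addr0.
  by rewrite -scalerA eb scaler0.
elim: x n => [|[s k] x IHx] n /=.
  move=> ->; apply: left_filter_up (left_filter_setT f) (ideal_ann _) _.
  by move=> r _ /=; rewrite scaler0.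
move=> [r [n' [er /IHx Fn' ->]]].
have r0 : f r = 0 by rewrite er rmorph0 mul0r.
apply: left_filter_up (left_filterI LF (LF.2 r r0) Fn') (ideal_ann _) _.
move=> a [ar an']; rewrite /left_annihilator /= in ar an' *.
by rewrite scalerDr an' addr0 scalerA ar scale0r.
Qed.

Definition common_numerators x y : set R :=
  [set j | exists2 n, numerator x j n & numerator y j n].

Lemma common_numerators_ideal x y : left_ideal (common_numerators x y).
Proof.
split=> [|i j [m xm ym] [n xn yn]|r j [n xn yn]].
- by exists 0; apply: numerator0.
- by exists (m + n); apply: numeratorD.
- by exists (r *: n); apply: numeratorZ.
Qed.

Lemma common_numerators_refl x : F (common_numerators x x).
Proof.
elim: x => [|[s m] x IHx].
  apply: left_filter_up (left_filter_setT f) (common_numerators_ideal _ _) _.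
  by move=> j _; exists 0.
apply: left_filter_up (left_filterI LF (LF.1 s) IHx)
  (common_numerators_ideal _ _) _.
by move=> j [[r _ er] [n xn _]]; exists (r *: m + n); exists r, n.
Qed.

(** If m and n are numerators of x and z over j, each shared with y, then
    m - n is a numerator of y over 0, hence is killed by the r in a member of
    the filter, and r m = r n is a common numerator of x and z over r j. *)
Lemma common_numerators_trans x y z : F (common_numerators x y) ->
  F (common_numerators y z) -> F (common_numerators x z).
Proof.
move=> Fxy Fyz; apply: left_filter_local (common_numerators_ideal _ _)
  (left_filterI LF Fxy Fyz) _ => j [[m xm ym] [n yn zn]].
have hj := numeratorD ym (numeratorZ (- 1) yn).
rewrite mulN1r scaleN1r subrr in hj.
apply: left_filter_up (numerator_torsion hj) _ _.
  exact/left_ideal_colon/common_numerators_ideal.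
move=> r /= /eqP; rewrite scalerBr subr_eq0 => /eqP rmn.
by exists (r *: m); [exact: numeratorZ|rewrite rmn; apply: numeratorZ].
Qed.

Lemma common_numerators_cat x y x' y' : F (common_numerators x x') ->
  F (common_numerators y y') -> F (common_numerators (x ++ y) (x' ++ y')).
Proof.
move=> Fx Fy; apply: left_filter_up (left_filterI LF Fx Fy)
  (common_numerators_ideal _ _) _ => j [[m xm x'm] [n yn y'n]].
by exists (m + n); apply: numerator_cat.
Qed.

(** Each defining relation of the tensor product relates sums which acquire
    a common numerator over a member of the filter. *)
Lemma tensor_rel_common_numerators x y : tensor_rel x y ->
  F (common_numerators x y).
Proof.
have up1 (s : SR) v w : (forall j r, f r = f j * (s : S) ->
    exists2 n, numerator v j n & numerator w j n) -> F (common_numerators v w).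
  move=> h; apply: left_filter_up (LF.1 s) (common_numerators_ideal _ _) _.
  by move=> j [r _ er]; apply: h er.
elim=> {x y} /=.
- exact: common_numerators_refl.
- move=> x y _ Fxy; apply: left_filter_up Fxy (common_numerators_ideal _ _) _.
  by move=> j [n xn yn]; exists n.
- by move=> x y z _ Fxy _; apply: common_numerators_trans.
- by move=> x y x' y' _ Fx _; apply: common_numerators_cat.
- move=> x y; apply: left_filter_up (common_numerators_refl (x ++ y))
    (common_numerators_ideal _ _) _ => j [n xyn _]; exists n => //.
  have [n1 [n2 [xn1 yn2 ->]]] := numerator_cat_split xyn.
  by rewrite addrC; apply: numerator_cat.
- move=> n; apply: (up1 0) => j r er; exists 0 => //=.
  exists 0, 0; split=> //; last by rewrite scale0r addr0.
  by rewrite rmorph0 [RHS]mulr0.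
- move=> s s' n.
  apply: left_filter_up (left_filterI LF (LF.1 s) (LF.1 s'))
    (common_numerators_ideal _ _) _ => j [[r _ er] [r' _ er']].
  exists ((r + r') *: n) => /=.
    exists (r + r'), 0; split=> //; last by rewrite addr0.
    by rewrite rmorphD er er' [RHS]mulrDr.
  exists r, (r' *: n); split=> //; last by rewrite scalerDl.
  by exists r', 0; split=> //; rewrite addr0.
- move=> s n n'; apply: (up1 s) => j r er; exists (r *: (n + n')) => /=.
    by exists r, 0; split=> //; rewrite addr0.
  exists r, (r *: n'); split=> //; last by rewrite scalerDr.
  by exists r, 0; split=> //; rewrite addr0.
- move=> s q n; apply: (up1 s) => j r er; exists (r *: (q *: n)) => /=.
    exists (r * q), 0; split=> //; last by rewrite addr0 scalerA.
    by rewrite rmorphM er [RHS]mulrA.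
  by exists r, 0; split=> //; rewrite addr0.
Qed.

Lemma numerator_tensor x j n (t : S) : numerator x j n ->
  \sum_(p <- x) pure_tensor (t * (f j * (p.1 : S)) : SR) p.2 =
  pure_tensor (t : SR) n.
Proof.
elim: x n => [|[s m] x IHx] n /=.
  by move=> ->; rewrite big_nil pure_tensor0r.
move=> [r [n' [er xn' ->]]]; rewrite big_cons (IHx _ xn') pure_tensorDr /=.
by congr (_ + _); rewrite -er -pure_tensorZ.
Qed.

(** The scalars t of S with t x = t y form a left ideal which contains f(j)
    for every j over which x and y have a common numerator. *)
Lemma common_numerators_tensor_rel x y : F (common_numerators x y) ->
  tensor_rel x y.
Proof.
move=> Fxy; apply/tensorP; rewrite !tensor_piE.
pose act (t : S) x := \sum_(p <- x) pure_tensor (t * (p.1 : S) : SR) p.2.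
pose X := [set t | forall r, act (r * t) x = act (r * t) y].
have actD t t' w : act (t + t') w = act t w + act t' w.
  rewrite -big_split /=; apply: eq_bigr => p _.
  by rewrite mulrDl pure_tensorDl.
have act0 w : act 0 w = 0.
  by apply: (addrI (act 0 w)); rewrite -actD !addr0.
have : X 1.
  apply: (left_filter_ind (X := X) Fxy) => [|j [n xn yn] r].
    split=> [r|t t' et et' r|s t et r]; first by rewrite mulr0 !act0.
      by rewrite mulrDr !actD et et'.
    by rewrite mulrA et.
  have actE w : act (r * f j) w =
      \sum_(p <- w) pure_tensor (r * (f j * (p.1 : S)) : SR) p.2.
    by apply: eq_bigr => p _; rewrite mulrA.
  by rewrite !actE (numerator_tensor r xn) (numerator_tensor r yn).
have act1 w : act (1 * 1) w = \sum_(p <- w) pure_tensor p.1 p.2.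
  by apply: eq_bigr => p _; rewrite mul1r [1 * _]mul1r.
by move=> /(_ 1); rewrite !act1.
Qed.

End Numerators.

Lemma numerator_map (N N' : lmodType R) (v : {linear N -> N'})
    (x : seq (SR * N)) j n' :
  numerator [seq (p.1, v p.2) | p <- x] j n' ->
  exists2 n, n' = v n & numerator x j n.
Proof.
elim: x n' => [|[s m] x IHx] n' /=; first by exists 0; rewrite // linear0.
move=> [r [_ [er /IHx[n -> xn] ->]]].
by exists (r *: m + n); [rewrite linearP|exists r, n].
Qed.

(** Two formal sums are equal in S (x) N exactly when they have a common
    numerator over a member of the filter, and this property is reflected by
    an injective v, which acts on numerators. *)
Lemma left_fractions_flat : flat_right SR.
Proof.
move=> N N' v v_inj; apply/tensor_map_injective => x y /= h.
apply: common_numerators_tensor_rel.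
apply: left_filter_up (tensor_rel_common_numerators h)
  (common_numerators_ideal _ _) _ => j [n' /numerator_map[n -> xn]].
by move=> /numerator_map[m /v_inj <- yn]; exists n.
Qed.

End FractionsFlat.

(** * Epimorphisms and the trivial extension *)

Section TrivialExtension.
Variables (S : pzRingType) (A : zmodType) (l : S -> A -> A) (r : A -> S -> A).
Hypotheses (lM : forall s t a, l (s * t) a = l s (l t a))
           (l1 : forall a, l 1 a = a)
           (lDl : forall s t a, l (s + t) a = l s a + l t a)
           (lDr : forall s a b, l s (a + b) = l s a + l s b)
           (rM : forall s t a, r a (s * t) = r (r a s) t)
           (r1 : forall a, r a 1 = a)
           (rDl : forall s a b, r (a + b) s = r a s + r b s)
           (rDr : forall s t a, r a (s + t) = r a s + r a t)
           (lr : forall s t a, l s (r a t) = r (l s a) t).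

(** The trivial extension of S by the bimodule A is S * A with A^2 = 0.  The
    maps sending s to (s, 0) and to (s, s z - z s) are ring homomorphisms
    into it, because commutation with z is a derivation, and they agree on
    f(R) when f(R) centralizes z. *)
Lemma epimorphism_centralizes (R : pzRingType) (f : {rmorphism R -> S})
    (z : A) : ring_epimorphism f ->
  (forall x, l (f x) z = r z (f x)) -> forall s, l s z = r z s.
Proof.
move=> epi fz.
have l0 s : l s 0 = 0 by apply: (addrI (l s 0)); rewrite -lDr !addr0.
have r0 s : r 0 s = 0 by apply: (addrI (r 0 s)); rewrite -rDl !addr0.
have lB s a b : l s (a - b) = l s a - l s b.
  by apply/eqP; rewrite eq_sym subr_eq -lDr subrK.
have rB s a b : r (a - b) s = r a s - r b s.
  by apply/eqP; rewrite eq_sym subr_eq -rDl subrK.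
pose mul (p q : S * A) : S * A := (p.1 * q.1, l p.1 q.2 + r p.2 q.1).
have mulA : associative mul.
  move=> [s a] [t b] [u c]; rewrite /mul /=; congr (_, _).
    by rewrite mulrA.
  by rewrite lM rM lDr rDl lr addrA.
have mul1 : left_id ((1, 0) : S * A) mul.
  by move=> [s a]; rewrite /mul /= mul1r l1 r0 addr0.
have mulr1' : right_id ((1, 0) : S * A) mul.
  by move=> [s a]; rewrite /mul /= mulr1 r1 l0 add0r.
have mulDl : left_distributive mul +%R.
  move=> [s a] [t b] [u c]; rewrite /mul /=; congr (_, _).
    by rewrite mulrDl.
  by rewrite lDl rDl addrACA.
have mulDr : right_distributive mul +%R.
  move=> [s a] [t b] [u c]; rewrite /mul /=; congr (_, _).
    by rewrite mulrDr.
  by rewrite lDr rDr addrACA.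
pose T : pzRingType := HB.pack (S * A)%type
  (GRing.Zmodule_isPzRing.Build (S * A)%type mulA mul1 mulr1' mulDl mulDr).
pose g (s : S) : T := (s, 0).
pose h (s : S) : T := (s, l s z - r z s).
have gB : zmod_morphism g.
  by move=> s t; rewrite /g; congr (_, _); rewrite subrr.
have lBl s t : l (s - t) z = l s z - l t z.
  by apply/eqP; rewrite eq_sym subr_eq -lDl subrK.
have rBr s t : r z (s - t) = r z s - r z t.
  by apply/eqP; rewrite eq_sym subr_eq -rDr subrK.
have hB : zmod_morphism h.
  move=> s t; rewrite /h; congr (_, _).
  by rewrite lBl rBr /= !opprB addrACA [RHS]addrACA [X in _ + X]addrC.
have gM : monoid_morphism g.
  split=> // s t; rewrite /g; congr (_, _).
  by rewrite /= l0 r0 addr0.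
have hM : monoid_morphism h.
  split=> [|s t]; first by rewrite /h l1 r1 subrr.
  rewrite /h; congr (_, _); rewrite /= lB rB lM rM lr.
  by rewrite addrA subrK.
pose g' : {rmorphism S -> T} := HB.pack g
  (GRing.isZmodMorphism.Build _ _ g gB) (GRing.isMonoidMorphism.Build _ _ g gM).
pose h' : {rmorphism S -> T} := HB.pack h
  (GRing.isZmodMorphism.Build _ _ h hB) (GRing.isMonoidMorphism.Build _ _ h hM).
have gh : g' \o f =1 h' \o f.
  by move=> x; rewrite /= /g /h fz subrr.
move=> s; have [] := epi T g' h' gh s.
by move/eqP; rewrite eq_sym subr_eq0 => /eqP.
Qed.

End TrivialExtension.

Section EpimorphismTensor.
Variables (R S : pzRingType) (f : {rmorphism R -> S}).

Local Notation SR := (right_restr f).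
Local Notation SL := (left_restr f).

Definition lmul (s : S) (t : SR) : SR := s * (t : S).
Definition rmul (s : S) (t : SL) : SL := (t : S) * s.

Fact lmul_additive s : zmod_morphism (lmul s).
Proof. by move=> t t'; apply: mulrBr. Qed.
Fact lmul_scalable s : scalable (lmul s).
Proof. by move=> x t; apply: mulrA. Qed.
HB.instance Definition _ s :=
  GRing.isZmodMorphism.Build SR SR (lmul s) (lmul_additive s).
HB.instance Definition _ s :=
  GRing.isScalable.Build R^c SR SR *:%R (lmul s) (lmul_scalable s).

Fact rmul_additive s : zmod_morphism (rmul s).
Proof. by move=> t t'; apply: mulrBl. Qed.
Fact rmul_scalable s : scalable (rmul s).
Proof. by move=> x t; apply/esym/mulrA. Qed.
HB.instance Definition _ s :=
  GRing.isZmodMorphism.Build SL SL (rmul s) (rmul_additive s).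
HB.instance Definition _ s :=
  GRing.isScalable.Build R SL SL *:%R (rmul s) (rmul_scalable s).

(** S (x)_R S is an S-bimodule in which f(R) centralizes 1 (x) 1. *)
Lemma epimorphism_tensor : ring_epimorphism f -> forall s : S,
  pure_tensor (s : SR) (1 : SL) = pure_tensor (1 : SR) (s : SL).
Proof.
move=> epi s.
pose l s (x : tensor SR SL) :=
  tensor_map (lmul s) (idfun : {linear SL -> SL}) x.
pose r (x : tensor SR SL) s :=
  tensor_map (idfun : {linear SR -> SR}) (rmul s) x.
have lE t m n : l t (pure_tensor m n) = pure_tensor (lmul t m) n.
  exact: tensor_map_pure.
have rE t m n : r (pure_tensor m n) t = pure_tensor m (rmul t n).
  exact: tensor_map_pure.
have lD t x y : l t (x + y) = l t x + l t y by exact: tensor_mapD.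
have rD t x y : r (x + y) t = r x t + r y t by exact: tensor_mapD.
have l0 t : l t 0 = 0 by exact: tensor_map0.
have r0 t : r 0 t = 0 by exact: tensor_map0.
have := @epimorphism_centralizes S (tensor SR SL) l r _ _ _ lD _ _ rD _ _
  R f (pure_tensor (1 : SR) (1 : SL)) epi _ s.
rewrite lE rE /lmul /rmul mulr1 mul1r; apply.
- move=> t t' x; elim/tensor_ind: x => [|m n x IHx]; first by rewrite !l0.
  by rewrite !lD !lE IHx /lmul mulrA.
- move=> x; elim/tensor_ind: x => [|m n x IHx]; first by rewrite !l0.
  by rewrite !lD !lE IHx /lmul mul1r.
- move=> t t' x; elim/tensor_ind: x => [|m n x IHx]; first by rewrite !l0 addr0.
  by rewrite !lD !lE IHx /lmul mulrDl pure_tensorDl addrACA.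
- move=> t t' x; elim/tensor_ind: x => [|m n x IHx]; first by rewrite !r0.
  by rewrite !rD !rE IHx /rmul mulrA.
- move=> x; elim/tensor_ind: x => [|m n x IHx]; first by rewrite !r0.
  by rewrite !rD !rE IHx /rmul mulr1.
- move=> t t' x; elim/tensor_ind: x => [|m n x IHx]; first by rewrite !r0 addr0.
  by rewrite !rD !rE IHx /rmul mulrDr pure_tensorDr addrACA.
- move=> t t' x; elim/tensor_ind: x => [|m n x IHx]; first by rewrite !(r0, l0).
  by rewrite !(rD, lD, rE, lE) IHx.
- move=> x; rewrite lE rE /lmul /rmul mulr1 mul1r.
  have := pure_tensorZ (1 : SR) x (1 : SL).
  by rewrite -[(x : R^c) *: _]/(1 * f x) mul1r -[x *: _]/(f x * 1) mulr1.
Qed.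

End EpimorphismTensor.

(** * Flat epimorphisms are given by fractions *)

Section Submodule.
Variables (R : pzRingType) (L : lmodType R).

(** Submodules as possibly undecidable subsets; their carriers become modules
    through the boolean predicate below. *)
Record submodule := Submodule {
  submodule_set :> L -> Prop;
  submodule0 : submodule_set 0;
  submoduleP : forall a u v, submodule_set u -> submodule_set v ->
    submodule_set (a *: u + v) }.

Variable P : submodule.

Lemma submoduleZ a u : P u -> P (a *: u).
Proof.
by move=> Pu; rewrite -[_ *: _]addr0; apply/submoduleP/submodule0.
Qed.

Lemma submoduleB u v : P u -> P v -> P (u - v).
Proof.
by move=> Pu Pv; rewrite addrC -scaleN1r; apply: submoduleP.
Qed.

Definition submodule_pred : {pred L} := fun y => `[< P y >].

Fact submodule_pred_closed : submod_closed submodule_pred.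
Proof.
split=> [|a u v]; first exact/asboolP/submodule0.
by move=> /asboolP Pu /asboolP Pv; apply/asboolP/submoduleP.
Qed.

HB.instance Definition _ := GRing.isSubmodClosed.Build R L submodule_pred
  submodule_pred_closed.

Definition submodule_type : Type := {y | y \in submodule_pred}.

HB.instance Definition _ := [isSub of submodule_type for @sval _ _].
HB.instance Definition _ := [Choice of submodule_type by <:].
HB.instance Definition _ := [SubChoice_isSubLmodule of submodule_type by <:].

End Submodule.

Section FlatFractions.
Variables (R S : pzRingType) (f : {rmorphism R -> S}).

Local Notation SR := (right_restr f).
Hypothesis flat : flat_right SR.

Section Transporter.
Variables (L : lmodType R) (K : submodule L) (x : L).

Definition add_cyclic_set (y : L) := exists r, K (y - r *: x).

Fact add_cyclic0 : add_cyclic_set 0.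
Proof. by exists 0; rewrite scale0r subrr; apply: submodule0. Qed.
Fact add_cyclicP a u v : add_cyclic_set u -> add_cyclic_set v ->
  add_cyclic_set (a *: u + v).
Proof.
move=> [r Ku] [q Kv]; exists (a * r + q).
by rewrite scalerDl opprD addrACA -scalerA -scalerBr; apply: submoduleP.
Qed.

(** The submodule K + R x. *)
Definition add_cyclic : submodule L := Submodule add_cyclic0 add_cyclicP.

Local Notation N := (submodule_type add_cyclic).

(** By flatness the equality already holds in S (x) (K + R x).  Sending
    s (x) (c + r x), with c in K, to the class of s f(r) defines a map from
    there to S / S f(I), where I is the set of r with r x in K: two choices
    of r for the same element differ by an element of I.  This map sends
    1 (x) x to the class of 1 and t (x) k to 0, hence 1 is in S f(I). *)
Lemma flat_transporter (t : S) (k : L) : K k ->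
  pure_tensor (1 : SR) x = pure_tensor (t : SR) k ->
  left_filter f [set r | K (r *: x)].
Proof.
move=> Kk xk; pose I := [set r | K (r *: x)].
have hI : left_ideal I.
  rewrite /I; split=> [|r q|r q] /=.
  - by rewrite scale0r; apply: submodule0.
  - move=> Kr Kq; rewrite scalerDl -[r *: x]scale1r.
    exact: submoduleP.
  - by rewrite -scalerA; apply: submoduleZ.
apply: left_filter_intro => // X [X0 XD XM] IX.
have XN s : X s -> X (- s) by move=> Xs; rewrite -mulN1r; apply: XM.
have Nx : x \in submodule_pred add_cyclic.
  by apply/asboolP; exists 1; rewrite scale1r subrr; apply: submodule0.
have Nk : k \in submodule_pred add_cyclic.
  by apply/asboolP; exists 0; rewrite scale0r subr0.
pose x' : N := exist _ x Nx; pose k' : N := exist _ k Nk.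
(* phi n is some r with n in K + r x, and h the map to S / S f(I), lifted to
   formal sums; X stands for S f(I). *)
pose phi (n : N) : R := xget 0 [set r | K (val n - r *: x)].
have phiP n : K (val n - phi n *: x).
  have /asboolP[r Kr] := valP n.
  by rewrite /phi; case: xgetP => [_ _ //|/(_ r)].
have phiE n r s : K (val n - r *: x) -> X (s * f (phi n) - s * f r).
  move=> Kr; rewrite -mulrBr -rmorphB; apply/XM/IX => /=.
  have := submoduleB Kr (phiP n).
  by rewrite opprB addrC subrKA scalerBl.
pose h (z : seq (SR * N)) : S := \sum_(p <- z) (p.1 : S) * f (phi p.2).
have hX y z : tensor_rel y z -> X (h y - h z).
  rewrite /h; elim=> {y z} /=.
  - by move=> y; rewrite subrr.
  - by move=> y z _ /XN; rewrite opprB.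
  - by move=> y z w _ Xyz _ Xzw; rewrite -(subrKA (h z)); apply: XD.
  - by move=> y z y' z' _ Xy _ Xz; rewrite !big_cat /= opprD addrACA; apply: XD.
  - by move=> y z; rewrite !big_cat /= [X in _ - X]addrC subrr.
  - by move=> n; rewrite big_cons !big_nil mul0r addr0 subrr.
  - move=> s s' n; rewrite !big_cons !big_nil !addr0 /= mulrDl.
    by rewrite subrr.
  - move=> s n n'; rewrite !big_cons !big_nil !addr0 /=.
    rewrite -mulrDr -rmorphD; apply: phiE.
    by rewrite scalerDl opprD addrACA -[val n - _]scale1r; apply: submoduleP.
  - move=> s r n; rewrite !big_cons !big_nil !addr0 /=.
    rewrite -opprB; apply: XN.
    rewrite -[X in _ - X]/(s * f r * f (phi n)) -mulrA -rmorphM; apply: phiE.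
    by rewrite -scalerA -scalerBr; apply: submoduleZ.
have : tensor_rel [:: ((1 : S) : SR, x')] [:: ((t : S) : SR, k')].
  have /tensor_map_injective := flat (v := val : {linear N -> L}) val_inj.
  by apply=> /=; apply/tensorP.
move/hX; rewrite /h !big_cons !big_nil !addr0 /= => X1.
have X2 := XN _ (phiE x' 1 1 _); have X3 := phiE k' 0 t _.
have -> : (1 : S) = (1 * f (phi x') - t * f (phi k'))
   + - (1 * f (phi x') - 1 * f 1) + (t * f (phi k') - t * f 0).
  rewrite rmorph0 mulr0 subr0 rmorph1 mul1r mulr1 opprB addrAC.
  by rewrite subrK [RHS]addrC subrK.
apply: (XD); last by apply: X3; rewrite scale0r subr0.
by apply: XD => //; apply: X2; rewrite scale1r subrr; apply: submodule0.
Qed.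

End Transporter.

Fact range_submoduleP a (u v : left_restr f) : range f u -> range f v ->
  range f (a *: u + v).
Proof.
by move=> [x _ <-] [y _ <-]; exists (a * x + y); rewrite // rmorphD rmorphM.
Qed.

Definition range_submodule : submodule (left_restr f) :=
  @Submodule R (left_restr f) (range f)
    (ex_intro2 _ _ 0 I (rmorph0 f)) range_submoduleP.

Fact zero_submoduleP (L : lmodType R) a (u v : L) : u = 0 -> v = 0 ->
  a *: u + v = 0.
Proof. by move=> -> ->; rewrite scaler0 addr0. Qed.

Definition zero_submodule (L : lmodType R) : submodule L :=
  @Submodule R L [set 0] (erefl (0 : L)) (@zero_submoduleP L).

(** In S (x) S one has 1 (x) s = s (x) 1 with 1 in f(R), so s is transported
    into f(R) by a member of the filter.  If f(a) = 0, then in S (x) R one has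
    1 (x) a = f(a) (x) 1 = 0, so a is transported into 0. *)
Lemma epimorphism_flat_fractions : ring_epimorphism f -> left_fractions f.
Proof.
move=> epi; split=> [s|a fa0].
  apply: (@flat_transporter (left_restr f) range_submodule s s 1).
    by exists 1; rewrite // rmorph1.
  by rewrite (epimorphism_tensor epi).
apply: (@flat_transporter R^o (zero_submodule R^o) a 0 0) => //.
have /= := pure_tensorZ (1 : SR) a (1 : R^o).
rewrite -[_ *: (1 : SR)]/(1 * f a) fa0 mulr0 -[_ *: (1 : R^o)]/(a * 1) mulr1.
by move=> <-; rewrite !pure_tensor0l.
Qed.

End FlatFractions.

(** * The equivalence *)

Theorem theorem4p1 (R S : pzRingType) (f : {rmorphism R -> S}) :
  let cond1 :=
    [/\ ring_epimorphism f, flat_left (left_restr f) &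
        flat_right (right_restr f)] in
  let cond2 :=
    exists (Gl : left_gabriel_filter (left_filter f))
           (Gr : right_gabriel_filter (right_filter f))
           (g : {rmorphism S -> symquot Gl Gr}),
      bijective g /\ g \o f =1 symquot_can Gl Gr in
  let cond3 :=
    (forall s : S,
       exists (n m : nat) (r : 'I_n -> R) (t : 'I_n -> S)
              (r' : 'I_m -> R) (t' : 'I_m -> S),
         [/\ forall i, range f (f (r i) * s),
             forall j, range f (s * f (r' j)),
             \sum_(i < n) t i * f (r i) = 1 &
             \sum_(j < m) f (r' j) * t' j = 1]) /\
    (forall a : R, f a = 0 ->
       exists (n m : nat) (r : 'I_n -> R) (t : 'I_n -> S)
              (r' : 'I_m -> R) (t' : 'I_m -> S),
         [/\ forall i, r i * a = 0,
             forall j, a * r' j = 0,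
             \sum_(i < n) t i * f (r i) = 1 &
             \sum_(j < m) f (r' j) * t' j = 1]) in
  (cond1 <-> cond2) /\ (cond2 <-> cond3).
Proof.
move=> cond1 cond2 cond3.
have h13 : cond1 <-> left_fractions f /\ left_fractions (converse f).
  split=> [[epi fl fr]|[Ll Lr]].
    split; first exact: epimorphism_flat_fractions.
    apply: epimorphism_flat_fractions; first exact/flat_left_converse.
    exact: epimorphism_converse.
  split; first exact: left_fractions_epimorphism.
    exact/flat_left_converse/left_fractions_flat.
  exact: left_fractions_flat.
have h23 : cond2 <-> left_fractions f /\ left_fractions (converse f).
  split=> [[Gl [Gr [g [g_bij gf]]]]|[Ll Lr]].
    have g_inj := bij_inj g_bij.
    split; first exact: iso_left_fractions g_inj gf.
    exact: iso_right_fractions g_inj gf.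
  exists (left_fractions_gabriel Ll), (left_fractions_gabriel Lr).
  exact: fractions_iso.
have h33 : cond3 <-> left_fractions f /\ left_fractions (converse f).
  have idl s : left_ideal (left_transporter f (range f) s).
    exact/left_transporter_ideal.
  have idr s :
      left_ideal (left_transporter (converse f) (range (converse f)) s).
    exact/left_transporter_ideal.
  split=> [[c3 c3']|[[Ll La] [Lr La']]].
    split; split=> [s|a fa0].
    - have [n [m [r [t [r' [t' [hr _ e _]]]]]]] := c3 s.
      by apply/left_filterP => //; exists n, r, t.
    - have [n [m [r [t [r' [t' [hr _ e _]]]]]]] := c3' a fa0.
      by apply/left_filterP; [exact: left_annihilator_ideal|exists n, r, t].
    - have [n [m [r [t [r' [t' [_ hr' _ e']]]]]]] := c3 s.
      by apply/left_filterP => //; exists m, r', t'.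
    - have [n [m [r [t [r' [t' [_ hr' _ e']]]]]]] := c3' a fa0.
      by apply/left_filterP; [exact: left_annihilator_ideal|exists m, r', t'].
  split=> [s|a fa0].
    have [n [r [t [hr e]]]] := (left_filterP f (idl s)).1 (Ll s).
    have [m [r' [t' [hr' e']]]] := (left_filterP (converse f) (idr s)).1 (Lr s).
    by exists n, m, r, t, r', t'.
  have [n [r [t [hr e]]]] :=
    (left_filterP f (left_annihilator_ideal a)).1 (La a fa0).
  have [m [r' [t' [hr' e']]]] :=
    (left_filterP (converse f) (@left_annihilator_ideal R^c a)).1 (La' a fa0).
  by exists n, m, r, t, r', t'.
by split; [rewrite h13 h23|rewrite h23 h33].
Qed.
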